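(* Let $I\subset\mathbb R$ be a compact interval with interior $I^\circ$, let $\psi\in C^\infty(I)$ be real valued, and let $a\in C_0^\infty(\mathbb R^2)$ with $\operatorname{supp}(a)\subset I^\circ\times\mathbb R$. Assume that $0\notin\operatorname{supp}(a)$ and that $\psi(t)-t\psi'(t)\neq 0$ for all $t\in I$ (it is not assumed that $\psi''\ne0$ on $I$). Let $\lambda>0$. Then there exists a positive constant $C_\lambda$ such that $$\|S^\lambda_*f\|_2\le C_\lambda\|f\|_2\qquad\text{for all } f\in\mathscr S(\mathbb R^2).$$
   Context: $\mathscr S(\mathbb R^2)$ is the Schwartz space, $\|\cdot\|_p$ is the $L^p(\mathbb R^2)$ norm, and $r_+=\max(r,0)$. The Fourier transform is $\hat f(\xi)=\int_{\mathbb R^2}f(x)e^{-2\pi i\langle x,\xi\rangle}\,dx$. For $\lambda>0$ put $\sigma_\lambda(\xi)=a(\xi)(\xi_2-\psi(\xi_1))_+^\lambda$, where $\xi=(\xi_1,\xi_2)$, and for $R>0$ $$S^\lambda_Rf(x)=\int_{\mathbb R^2}\sigma_\lambda(R^{-1}\xi)\hat f(\xi)e^{2\pi i\langle x,\xi\rangle}\,d\xi,\qquad S^\lambda_*f(x)=\sup_{R>0}|S^\lambda_Rf(x)|.$$ *)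

(* Defs.v *)
From HB Require Import structures.
From mathcomp Require Import all_boot all_order all_algebra.
From mathcomp Require Import all_classical all_reals all_analysis.
From mathcomp Require Import complex.

Set Implicit Arguments.
Unset Strict Implicit.
Unset Printing Implicit Defensive.

Import Order.TTheory GRing.Theory Num.Theory.
Import numFieldNormedType.Exports.

Local Open Scope classical_set_scope.
Local Open Scope complex_scope.
Local Open Scope ring_scope.

Section Smoothness.
Context {R : realType}.

(* One-sided at the endpoints of an interval [I].  Only the values of [g] on
   [I] matter when [t] lies in [I], so [deriv_in I] can be iterated although
   its value outside [I] is meaningless. *)
Definition diff_quot (g : R -> R) (t s : R) : R := (g s - g t) / (s - t).

Definition deriv_in (I : set R) (g : R -> R) (t : R) : R :=
  lim (diff_quot g t @ within I t^').

Definition smooth_in (I : set R) (g : R -> R) : Prop :=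
  forall (n : nat) (t : R), I t ->
    cvg (diff_quot (iter n (deriv_in I) g) t @ within I t^').

Definition basis2 (b : bool) : R * R := if b then (0, 1) else (1, 0).

Definition pderivs (s : seq bool) (g : R * R -> R) : R * R -> R :=
  foldr (fun b h => 'D_(basis2 b) h) g s.

(* The words [s] run over all iterated mixed partial derivatives. *)
Definition smooth2 (g : R * R -> R) : Prop :=
  forall s : seq bool, continuous (pderivs s g) /\
    forall (b : bool) (x : R * R), derivable (pderivs s g) x (basis2 b).

Definition csmooth2 (f : R * R -> R[i]) : Prop :=
  smooth2 (fun x => complex.Re (f x)) /\ smooth2 (fun x => complex.Im (f x)).

Definition rapidly_decreasing (g : R * R -> R) : Prop :=
  forall (j k : nat) (s : seq bool), exists M : R, forall x : R * R,
    `|x.1 ^+ j * x.2 ^+ k * pderivs s g x| <= M.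

Definition schwartz (f : R * R -> R[i]) : Prop :=
  [/\ csmooth2 f, rapidly_decreasing (fun x => complex.Re (f x))
    & rapidly_decreasing (fun x => complex.Im (f x))].

Definition supp (f : R * R -> R[i]) : set (R * R) :=
  closure [set x | f x != 0].

Definition test_function (f : R * R -> R[i]) : Prop :=
  csmooth2 f /\ compact (supp f).

End Smoothness.

Section BochnerRiesz.
Context {R : realType}.

Definition leb2 :
    {measure set (measurableTypeR R * measurableTypeR R)%type -> \bar R} :=
  ((@lebesgue_measure R) \x (@lebesgue_measure R))%E.

Definition Cintegral (f : R * R -> R[i]) : R[i] :=
  (\int[leb2]_x complex.Re (f x)) +i* (\int[leb2]_x complex.Im (f x)).

Definition dot2 (x y : R * R) : R := x.1 * y.1 + x.2 * y.2.

Definition expi (t : R) : R[i] := cos t +i* sin t.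

Definition fourier (f : R * R -> R[i]) (xi : R * R) : R[i] :=
  Cintegral (fun x => f x * expi (- (2 * pi * dot2 x xi))).

(* [powR] satisfies [0 `^ lam = 0] for [lam != 0]. *)
Definition sigma (a : R * R -> R[i]) (psi : R -> R) (lam : R)
    (xi : R * R) : R[i] :=
  a xi * (Num.max (xi.2 - psi xi.1) 0 `^ lam)%:C.

Definition S_op (a : R * R -> R[i]) (psi : R -> R) (lam r : R)
    (f : R * R -> R[i]) (x : R * R) : R[i] :=
  Cintegral (fun xi =>
    sigma a psi lam (r^-1 *: xi) * fourier f xi * expi (2 * pi * dot2 x xi)).

Definition S_max (a : R * R -> R[i]) (psi : R -> R) (lam : R)
    (f : R * R -> R[i]) (x : R * R) : \bar R :=
  ereal_sup [set (Normc.normc (S_op a psi lam r f x))%:E | r in [set r | 0 < r]].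

End BochnerRiesz.

(* Main.v *)
Require Import Defs.
From HB Require Import structures.
From mathcomp Require Import all_boot all_order all_algebra.
From mathcomp Require Import all_classical all_reals all_analysis.
From mathcomp Require Import complex.
From mathcomp Require Import measurable_realfun ring lra.

Import Order.TTheory GRing.Theory Num.Theory.
Import numFieldNormedType.Exports.

Local Open Scope classical_set_scope.
Local Open Scope ring_scope.

Set Implicit Arguments.
Unset Strict Implicit.
Unset Printing Implicit Defensive.

(** The supremum over dilations is controlled by the increments of the operator
    over dyadic grids of dilation parameters, whose squares are summable because
    the multiplier has bounded variation along rays.

    Write r^-1 = e^s and u_xi(s) = sigma(e^s xi), so that the value at x of the
    operator at scale r is the integral of u_xi(s) against the Fourier
    transform of f times a wave in xi.  For a continuous function F of s >= 0,
    reaching s through its dyadic approximations and applying a weighted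
    Cauchy-Schwarz inequality gives, for any 0 < rho < 1,
    |F(s)|^2 <= (1 - rho)^-1 sum_k rho^-k sum_j |Delta_(k,j) F|^2,
    where Delta_(k,j) F are the increments of F over the grid of mesh 2^-k and,
    at k = 0, its values at the integers ([chaining]).  The right-hand side does
    not depend on s.  It is applied to F(s) = the operator at scale s evaluated
    at x, and integrated in x: every increment is again a multiplier operator,
    so the L^2 inequality [bessel] bounds the level k by the L^2 norm of f
    squared times sup_xi sum_j |Delta_(k,j) u_xi|^2.  The case s <= 0 is the
    same.  What remains is a bound of this supremum by C rho^(2k); the double
    series is then geometric ([half_maximal], [edge_maximal]).

    A sum of squared increments is at most their maximum times the variation,
    so it is enough that u_xi is Hoelder continuous of some exponent mu > 0 and of
    bounded variation, both uniformly in xi ([edge_holder], [edge_variation],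
    combined in [edge_increments] with rho = 2^(-mu/2)).  Hoelder continuity holds
    for any lambda > 0 because powers are Hoelder ([powR_holder]).  The
    variation is where the hypothesis on psi enters: on a ray xi = t w with t > 0,
    sigma(t w) = a(t w) t^lambda (w_2 - psi(t w_1) / t)_+^lambda,
    and the derivative in t of w_2 - psi(t w_1) / t is
    (psi(y) - y psi'(y)) / t^2 at y = t w_1.  As psi(y) - y psi'(y) has a
    constant sign, the last factor is monotone in t; so is t^lambda, and a is
    Lipschitz along the ray, so the product has bounded variation.  The support
    of a is compact and misses the origin, so t stays in a compact subinterval
    of (0, oo); this also bounds the number of integers contributing at k = 0.

    A ray leaves the strip over I on which psi is given, so psi is first
    continued by its end tangents: psi(y) - y psi'(y) is the intercept of the
    tangent at y, hence takes no new values on the continuation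
    ([tangent_extension_bounded], [tangent_extension_sign]).

    The inequality [bessel] plays the role of Plancherel's identity, with a
    constant.  It follows from a T T* argument: the Schur test [schur_test] for
    the transform damped by a compactly supported weight whose own cosine
    transform has an integral bounded independently of the width
    ([bump_cos], [integral_bump_tail]), followed by Fatou's lemma as the weight
    increases to 1.  Real and imaginary parts of a, of the Fourier transform
    and of the wave are treated separately, and reassembled in
    [S_op_maximal] and [S_max_L2]. *)

(** * The planar measure and parameter integrals *)

Section planar_measure.
Context {R : realType}.

(** A named copy of [leb2], to which the sigma-finite structure needed by
    Fubini's theorem is attached. *)
Definition planar : set (measurableTypeR R * measurableTypeR R)%type -> \bar R :=
  @leb2 R.

HB.instance Definition _ := Measure.on planar.

Lemma planar_sigma_finite : sigma_finite setT planar.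
Proof.
have /sigma_finiteP[F [TF ndF Foo]] := sigma_finiteT (@lebesgue_measure R).
exists (fun n => F n `*` F n).
  rewrite -setXTT TF predeqE => -[x y]; split.
    move=> [/= [n _ Fnx] [k _ Fky]]; exists (maxn n k) => //; split.
    - by move: x Fnx; exact/subsetPset/ndF/leq_maxl.
    - by move: y Fky; exact/subsetPset/ndF/leq_maxr.
  by move=> [n _ []/= ? ?]; split; exists n.
move=> k; have [? ?] := Foo k.
split; first exact: measurableX.
by rewrite /planar/= product_measure1E// lte_mul_pinfty// ge0_fin_numE.
Qed.

HB.instance Definition _ :=
  Measure_isSigmaFinite.Build _ _ _ planar planar_sigma_finite.

End planar_measure.

Section parameter_integrals.
Context {d1 d2} {X : measurableType d1} {Y : measurableType d2} {R : realType}.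
Variables (m1 : {sigma_finite_measure set X -> \bar R}).
Variables (m2 : {sigma_finite_measure set Y -> \bar R}).

Lemma EFin_Rintegral {d} {T : measurableType d} (m : {measure set T -> \bar R})
    (f : T -> R) : m.-integrable setT (EFin \o f) ->
  (Rintegral m setT f)%:E = (\int[m]_x (f x)%:E)%E.
Proof. by move=> fi; rewrite /Rintegral fineK//; exact: integrable_fin_num. Qed.

Lemma measurable_integral_snd (f : X * Y -> \bar R) : measurable_fun setT f ->
  measurable_fun setT (fun y => \int[m1]_x f (x, y))%E.
Proof.
move=> mf.
have -> : (fun y => \int[m1]_x f (x, y))%E =
    (fun y => \int[m1]_x (f^\+ (x, y)) - \int[m1]_x (f^\- (x, y)))%E.
  apply/funext => y; rewrite integralE.
  have -> : (fun x => f (x, y))^\+%E = (fun x => f^\+ (x, y))%E.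
    by apply/funext => x; rewrite !funeposE.
  have -> : (fun x => f (x, y))^\-%E = (fun x => f^\- (x, y))%E.
    by apply/funext => x; rewrite !funenegE.
  by [].
apply: emeasurable_funB.
- apply: (measurable_fun_fubini_tonelli_G (f^\+%E)) => //.
  exact: measurable_funepos.
- apply: (measurable_fun_fubini_tonelli_G (f^\-%E)) => //.
  exact: measurable_funeneg.
Qed.

Lemma measurable_Rintegral_snd (f : X * Y -> R) : measurable_fun setT f ->
  measurable_fun setT (fun y => Rintegral m1 setT (fun x => f (x, y))).
Proof.
move=> mf; apply: (measurableT_comp (fine_measurable measurableT)).
by apply: (measurable_integral_snd (f := EFin \o f)); exact/measurable_EFinP.
Qed.

Lemma integrable_le {d} {T : measurableType d} (m : {measure set T -> \bar R})
    (f g : T -> R) : measurable_fun setT f ->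
  (forall x, `|f x| <= g x) -> m.-integrable setT (EFin \o g) ->
  m.-integrable setT (EFin \o f).
Proof.
move=> mf fg; apply: le_integrable => //; first exact/measurable_EFinP.
by move=> x _; rewrite /= lee_fin (le_trans (fg x))// ler_norm.
Qed.

(** When the integral on the left is infinite its real value is 0 by convention. *)
Lemma abs_Rintegral_le {d} {T : measurableType d}
    (m : {measure set T -> \bar R}) (f : T -> R) : measurable_fun setT f ->
  (`|Rintegral m setT f|%:E <= \int[m]_x (`|f x|)%:E)%E.
Proof.
move=> mf.
have /measurable_EFinP/(le_abse_integral m measurableT) := mf.
apply: le_trans; rewrite /Rintegral.
by case: (integral _ _ _) => [r| |] //=; rewrite normr0 leey.
Qed.

Lemma le_abs_Rintegral {d} {T : measurableType d}
    (m : {measure set T -> \bar R}) (f g : T -> R) : measurable_fun setT f ->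
  (forall x, `|f x| <= g x) -> m.-integrable setT (EFin \o g) ->
  `|Rintegral m setT f| <= Rintegral m setT g.
Proof.
move=> mf fg ig.
have fi := integrable_le mf fg ig.
apply: (le_trans (le_normr_Rintegral measurableT fi)).
apply: le_Rintegral => //.
by move/integrable_abse : fi.
Qed.

Lemma integrable_indic_lty {d} {T : measurableType d}
    (m : {measure set T -> \bar R}) (A : set T) : measurable A ->
  (m A < +oo)%E -> m.-integrable setT (EFin \o \1_A).
Proof.
move=> mA Aoo; apply/integrableP; split.
  by apply/measurable_EFinP; exact: measurable_indic.
under eq_integral do rewrite /= ger0_norm//.
by rewrite integral_indic// setIT.
Qed.

Lemma integrable_prod (f : X -> R) (g : Y -> R) :
  m1.-integrable setT (EFin \o f) -> m2.-integrable setT (EFin \o g) ->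
  (m1 \x m2)%E.-integrable setT (EFin \o (fun z => f z.1 * g z.2)).
Proof.
move=> fi gi.
have mf : measurable_fun setT f by apply/measurable_EFinP; exact: measurable_int fi.
have mg : measurable_fun setT g by apply/measurable_EFinP; exact: measurable_int gi.
apply/integrable12ltyP.
  apply/measurable_EFinP; apply: measurable_funM;
    exact: measurableT_comp.
rewrite /=; under eq_integral => x _.
  under eq_integral do rewrite normrM EFinM.
  rewrite ge0_integralZl//; last by do 2 apply: measurableT_comp => //.
  over.
rewrite ge0_integralZr//=; last 2 first.
  by do 2 apply: measurableT_comp => //.
  by apply: integral_ge0.
move/integrableP : fi => [_ fi]; move/integrableP : gi => [_ gi].
by rewrite lte_mul_pinfty// ?integral_ge0// ge0_fin_numE// integral_ge0.
Qed.

Lemma Rintegral_prod (f : X -> R) (g : Y -> R) :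
  m1.-integrable setT (EFin \o f) -> m2.-integrable setT (EFin \o g) ->
  Rintegral (m1 \x m2)%E setT (fun z => f z.1 * g z.2) =
  Rintegral m1 setT f * Rintegral m2 setT g.
Proof.
move=> fi gi; apply: EFin_inj; rewrite EFin_Rintegral; last exact: integrable_prod.
rewrite -(integral12_prod_meas1 (integrable_prod fi gi)) /fubini_F/=.
under eq_integral => x _.
  under eq_integral do rewrite EFinM.
  rewrite integralZl// -EFin_Rintegral//.
  over.
by rewrite integralZr// -EFin_Rintegral// EFinM.
Qed.

End parameter_integrals.

(** * A Schur test for damped transforms *)
Section schur_test.
Context {d1 d2} {X : measurableType d1} {Y : measurableType d2} {R : realType}.
Variables (m1 : {sigma_finite_measure set X -> \bar R}).
Variables (m2 : {sigma_finite_measure set Y -> \bar R}).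
(** [E] is the bounded kernel of the transform [G] of [g], and [P] an integrable
    weight on the frequency side.  [K] dominates the kernel of T T* for the
    weighted transform T; its marginals are at most [C]. *)
Variables (E : X * Y -> R) (P : Y -> R) (K : X * X -> R) (C : R).
Hypothesis mE : measurable_fun setT E.
Hypothesis E1 : forall z, `|E z| <= 1.
Hypothesis P0 : forall y, 0 <= P y.
Hypothesis iP : m2.-integrable setT (EFin \o P).
Hypothesis mK : measurable_fun setT K.
Hypothesis K0 : forall z, 0 <= K z.
Hypothesis Ksym : forall x x', K (x, x') = K (x', x).
Hypothesis PK : forall x x',
  `|Rintegral m2 setT (fun y => P y * E (x, y) * E (x', y))| <= K (x, x').
Hypothesis KC : forall x, (\int[m1]_x' (K (x, x'))%:E <= C%:E)%E.
Variable g : X -> R.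
Hypothesis ig : m1.-integrable setT (EFin \o g).

Let G y := Rintegral m1 setT (fun x => g x * E (x, y)).
Let A := Rintegral m1 setT (fun x => `|g x|).

Let mP : measurable_fun setT P.
Proof. by apply/measurable_EFinP; exact: measurable_int iP. Qed.

Let mg : measurable_fun setT g.
Proof. by apply/measurable_EFinP; exact: measurable_int ig. Qed.

Let mgE : measurable_fun setT (fun z : X * Y => g z.1 * E z).
Proof. by apply: measurable_funM => //; exact: measurableT_comp. Qed.

Let mG : measurable_fun setT G.
Proof. exact: (measurable_Rintegral_snd m1 mgE). Qed.

Let iag : m1.-integrable setT (EFin \o (fun x => `|g x|)).
Proof. by move/integrable_abse : ig. Qed.

Let mE1 x : measurable_fun setT (fun y => E (x, y)).
Proof. exact: measurableT_comp. Qed.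

Let mE2 y : measurable_fun setT (fun x => E (x, y)).
Proof. exact: measurableT_comp. Qed.

Let GA y : `|G y| <= A.
Proof.
apply: le_abs_Rintegral => //; first exact: measurable_funM.
by move=> x; rewrite normrM ler_piMr.
Qed.

Let A0 : 0 <= A.
Proof. by apply: Rintegral_ge0. Qed.

Let igE y : m1.-integrable setT (EFin \o (fun x => g x * E (x, y))).
Proof.
apply: integrable_le iag; first exact: measurable_funM.
by move=> x; rewrite normrM ler_piMr.
Qed.

Let iPEE x x' : m2.-integrable setT (EFin \o (fun y => P y * E (x, y) * E (x', y))).
Proof.
apply: integrable_le iP.
  by apply: measurable_funM => //; exact: measurable_funM.
move=> y; rewrite !normrM (ger0_norm (P0 y)) -mulrA ler_piMr//.
by rewrite mulr_ile1.
Qed.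

Let iAP : m2.-integrable setT (EFin \o (fun y => A * P y)).
Proof.
have -> : EFin \o (fun y => A * P y) = (fun y => A%:E * (EFin \o P) y)%E.
  by apply/funext => y /=; rewrite EFinM.
exact: integrableZl.
Qed.

Let I x := Rintegral m2 setT (fun y => P y * E (x, y) * G y).

Let iPEG x : m2.-integrable setT (EFin \o (fun y => P y * E (x, y) * G y)).
Proof.
apply: integrable_le iAP.
  apply: measurable_funM => //.
  exact: measurable_funM.
move=> y; rewrite /= normrM [leLHS]mulrC ler_pM//.
by rewrite normrM (ger0_norm (P0 y)) ler_piMr.
Qed.

(** Integrating the weighted transform back against [E] applies the kernel of
    T T* to [g]; the weight makes the double integral absolutely convergent. *)
Let IE x : I x = Rintegral m1 setT (fun x' => g x' *
  Rintegral m2 setT (fun y => P y * E (x, y) * E (x', y))).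
Proof.
pose phi (z : X * Y) := g z.1 * (P z.2 * E (x, z.2) * E z).
have iphi : (m1 \x m2)%E.-integrable setT (EFin \o phi).
  apply: (integrable_le _ _ (integrable_prod iag iP)).
    apply: measurable_funM; first exact: measurableT_comp.
    apply: measurable_funM => //.
    apply: measurable_funM; first exact: measurableT_comp.
    exact: (measurableT_comp (mE1 x)).
  move=> [x' y]; rewrite /phi /= !normrM (ger0_norm (P0 y)) ler_wpM2l//.
  by rewrite -mulrA ler_piMr// mulr_ile1.
rewrite /I /Rintegral; congr fine.
transitivity (\int[m2]_y \int[m1]_x' (phi (x', y))%:E)%E.
  apply: eq_integral => y _.
  rewrite EFinM EFin_Rintegral// -integralZl//; last exact: igE.
  by apply: eq_integral => x' _; rewrite /phi/= -EFinM; congr EFin; ring.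
apply: (etrans (esym (Fubini iphi))); apply: eq_integral => x' _.
rewrite EFinM fineK; last exact: (integrable_fin_num measurableT (iPEE x x')).
by rewrite -integralZl//; exact: iPEE.
Qed.

Let mKx x : measurable_fun setT (fun x' => K (x, x')).
Proof. exact: measurableT_comp. Qed.

Let mggK : measurable_fun setT (fun z : X * X => (`|g z.1| * (`|g z.2| * K z))%:E).
Proof.
apply/measurable_EFinP; apply: measurable_funM.
  by do 2 apply: measurableT_comp => //.
apply: measurable_funM => //.
by do 2 apply: measurableT_comp => //.
Qed.

Let ggK0 (z : X * X) : (0 <= (`|g z.1| * (`|g z.2| * K z))%:E)%E.
Proof. by rewrite lee_fin !mulr_ge0. Qed.

Let I_le x : (`|I x|%:E <= \int[m1]_x' (`|g x'| * K (x, x'))%:E)%E.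
Proof.
have mi : measurable_fun setT (fun x' => g x' *
    Rintegral m2 setT (fun y => P y * E (x, y) * E (x', y))).
  apply: measurable_funM => //.
  apply: (measurable_Rintegral_snd m2 (f := fun z : Y * X => P z.1 * E (x, z.1) * E (z.2, z.1))).
  apply: measurable_funM.
    apply: measurable_funM; first exact: measurableT_comp.
    exact: (measurableT_comp (mE1 x)).
  by apply: measurableT_comp => //; apply: measurable_fun_pair.
rewrite IE; apply: (@le_trans _ _ (\int[m1]_x' `|g x' *
    Rintegral m2 setT (fun y => P y * E (x, y) * E (x', y))|%:E)%E).
  exact: abs_Rintegral_le.
apply: ge0_le_integral => //.
- by do 2 apply: measurableT_comp => //.
- apply/measurable_EFinP; apply: measurable_funM => //.
  by apply: measurableT_comp => //.
- by move=> x' _; rewrite lee_fin normrM ler_wpM2l.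
Qed.

(** Expanding one factor of [G y ^+ 2] turns the left side into the double
    integral of [g x * g x'] against the kernel of T T*, which is at most that
    of [`|g x| * `|g x'| * K (x, x')]. *)
Lemma schur_test :
  (\int[m2]_y (P y * G y ^+ 2)%:E <= C%:E * \int[m1]_x (g x ^+ 2)%:E)%E.
Proof.
pose phi (z : X * Y) := g z.1 * (P z.2 * E z * G z.2).
have iphi : (m1 \x m2)%E.-integrable setT (EFin \o phi).
  apply: (integrable_le _ _ (integrable_prod iag iAP)).
    apply: measurable_funM; first exact: measurableT_comp.
    apply: measurable_funM; last exact: measurableT_comp.
    by apply: measurable_funM => //; exact: measurableT_comp.
  move=> [x y]; rewrite /phi /= !normrM (ger0_norm (P0 y)) ler_wpM2l//.
  by rewrite [leLHS]mulrC ler_pM// ?mulr_ge0// ler_piMr.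
have -> : (\int[m2]_y (P y * G y ^+ 2)%:E = \int[m1]_x (g x * I x)%:E)%E.
  transitivity (\int[m2]_y \int[m1]_x (phi (x, y))%:E)%E.
    apply: eq_integral => y _.
    have -> : P y * G y ^+ 2 = P y * G y * G y by ring.
    rewrite EFinM {2}/G EFin_Rintegral// -integralZl//; last exact: igE.
    by apply: eq_integral => x _; rewrite /phi/= -EFinM; congr EFin; ring.
  apply: (etrans (esym (Fubini iphi))); apply: eq_integral => x _.
  by rewrite EFinM /I EFin_Rintegral// -integralZl//; exact: iPEG.
have mI : measurable_fun setT I.
  apply: (measurable_Rintegral_snd m2 (f := fun z : Y * X => P z.1 * E (z.2, z.1) * G z.1)).
  apply: measurable_funM; last exact: measurableT_comp.
  apply: measurable_funM; first exact: measurableT_comp.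
  by apply: measurableT_comp => //; apply: measurable_fun_pair.
apply: (@le_trans _ _ (\int[m1]_x \int[m1]_x' (`|g x| * (`|g x'| * K (x, x')))%:E)%E).
  apply: (@le_trans _ _ (\int[m1]_x `|g x * I x|%:E)%E).
    have /measurable_EFinP/(le_abse_integral m1 measurableT) := measurable_funM mg mI.
    by apply: le_trans; exact: lee_abs.
  apply: ge0_le_integral => //.
  - by apply/measurable_EFinP; apply: measurableT_comp => //; exact: measurable_funM.
  - exact: (measurable_fun_fubini_tonelli_F _ mggK ggK0).
  - move=> x _; under eq_integral do rewrite EFinM.
    rewrite ge0_integralZl//; first by rewrite normrM EFinM lee_wpmul2l.
      apply/measurable_EFinP; apply: measurable_funM => //.
      exact: measurableT_comp.
    by move=> x' _; rewrite lee_fin mulr_ge0.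
have mg2 : measurable_fun setT (fun x => g x ^+ 2) by exact: measurable_funX.
pose half : R := 2^-1.
have half0 : 0 <= half by rewrite invr_ge0.
have msq1 : measurable_fun setT (fun z : X * X => (half * g z.1 ^+ 2 * K z)%:E).
  apply/measurable_EFinP; apply: measurable_funM => //.
  apply: measurable_funM => //.
  exact: (measurableT_comp mg2).
have msq2 : measurable_fun setT (fun z : X * X => (half * g z.2 ^+ 2 * K z)%:E).
  apply/measurable_EFinP; apply: measurable_funM => //.
  apply: measurable_funM => //.
  exact: (measurableT_comp mg2).
have hg0 x : 0 <= half * g x ^+ 2 by rewrite mulr_ge0// sqr_ge0.
(* [`|g x| * `|g x'|] is split by the arithmetic-geometric mean inequality; in
   each half one variable occurs only in the kernel and integrates to C *)
apply: (@le_trans _ _ (\int[m1]_x \int[m1]_x'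
    ((half * g x ^+ 2 * K (x, x'))%:E + (half * g x' ^+ 2 * K (x, x'))%:E))%E).
  rewrite -(fubini_tonelli1 (m1 := m1) (m2 := m1)
    (fun z : X * X => (`|g z.1| * (`|g z.2| * K z))%:E))//.
  rewrite -(fubini_tonelli1 (m1 := m1) (m2 := m1) (fun z : X * X =>
    (half * g z.1 ^+ 2 * K z)%:E + (half * g z.2 ^+ 2 * K z)%:E)%E)//; last 2 first.
  - exact: emeasurable_funD.
  - by move=> z; rewrite -EFinD lee_fin addr_ge0// mulr_ge0.
  apply: ge0_le_integral => //.
  - exact: emeasurable_funD.
  - move=> [x x'] _; rewrite -EFinD lee_fin /= mulrA -mulrDl ler_wpM2r//.
    rewrite -[g x ^+ 2]real_normK ?num_real// -[g x' ^+ 2]real_normK ?num_real//.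
    rewrite /half; have := sqr_ge0 (`|g x| - `|g x'|); lra.
rewrite -(fubini_tonelli1 (m1 := m1) (m2 := m1) (fun z : X * X =>
    (half * g z.1 ^+ 2 * K z)%:E + (half * g z.2 ^+ 2 * K z)%:E)%E)//; last 2 first.
- exact: emeasurable_funD.
- by move=> z; rewrite -EFinD lee_fin addr_ge0// mulr_ge0.
rewrite ge0_integralD//; last 2 first.
- by move=> z _; rewrite lee_fin mulr_ge0.
- by move=> z _; rewrite lee_fin mulr_ge0.
rewrite fubini_tonelli1//; last by move=> z; rewrite lee_fin mulr_ge0.
rewrite fubini_tonelli2//; last by move=> z; rewrite lee_fin mulr_ge0.
have bnd (h : X -> X -> R) : (forall x x', h x x' = K (x, x')) ->
    (\int[m1]_x \int[m1]_x' (half * g x ^+ 2 * h x x')%:E <=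
     half%:E * (C%:E * \int[m1]_x (g x ^+ 2)%:E))%E.
  move=> hK.
  have C0 : (0 <= C%:E)%E.
    by apply: le_trans (KC point); apply: integral_ge0 => x' _; rewrite lee_fin.
  apply: (@le_trans _ _ (\int[m1]_x ((half * C)%:E * (g x ^+ 2)%:E))%E).
    apply: ge0_le_integral => //.
    - by move=> x _; apply: integral_ge0 => x' _; rewrite hK lee_fin mulr_ge0.
    - apply: (eq_measurable_fun (fubini_F m1 (fun z : X * X => (half * g z.1 ^+ 2 * K z)%:E))).
        by move=> x _; apply: eq_integral => x' _ /=; rewrite hK.
      apply: measurable_fun_fubini_tonelli_F => //.
      by move=> z; rewrite lee_fin mulr_ge0.
    - by apply/measurable_EFinP; apply: measurable_funM.
    - move=> x _; under eq_integral do rewrite hK EFinM.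
      rewrite ge0_integralZl; [|exact: measurableT|exact/measurable_EFinP|
        by move=> x' _; rewrite lee_fin|by rewrite lee_fin].
      apply: le_trans (lee_wpmul2l _ (KC x)) _; first by rewrite lee_fin.
      by rewrite -!EFinM lee_fin le_eqVlt; apply/orP; left; apply/eqP; ring.
  rewrite ge0_integralZl; [|exact: measurableT|exact/measurable_EFinP|
    by move=> x _; rewrite lee_fin sqr_ge0|by rewrite lee_fin mulr_ge0].
  by rewrite EFinM muleA.
apply: le_trans (leeD (bnd (fun x x' => K (x, x')) _) (bnd (fun x x' => K (x', x)) _)) _ => //.
rewrite -ge0_muleDl; [|by rewrite lee_fin..].
have -> : (half%:E + half%:E)%E = 1%E :> \bar R by rewrite -EFinD /half; congr EFin; lra.
by rewrite mul1e.
Qed.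

End schur_test.

(** * A compactly supported weight with integrable cosine transform *)
Section bump.
Context {R : realType}.
Local Notation mu := (@lebesgue_measure R).

Lemma Rintegral_FTC (f F : R -> R) (a b : R) : a < b -> continuous f ->
  (forall x : R, is_derive x 1 F (f x)) ->
  Rintegral mu `[a, b] f = F b - F a.
Proof.
move=> ab cf dF.
have cF : continuous F.
  move=> x; apply: differentiable_continuous.
  by apply/derivable1_diffP; exact: ex_derive.
rewrite /Rintegral (@continuous_FTC2 _ f F)//.
- exact: continuous_subspaceT.
- split=> [x _||]; first exact: ex_derive.
  + exact/cvg_at_right_filter/cF.
  + exact/cvg_at_left_filter/cF.
- by move=> x _; rewrite derive1E derive_val.
Qed.

Definition bump (N y : R) : R := Num.max (1 - (y / N) ^+ 2) 0.

(** Up to a constant factor, N times a Poisson kernel profile in N b: it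
    majorizes the cosine transform of [bump N] and its integral does not
    depend on N. *)
Definition bump_tail (N b : R) : R := 16 * N / (1 + (N * b) ^+ 2).

Variable N : R.
Hypothesis N0 : 0 < N.

Lemma bump_restrict (h : R -> R) :
  (fun y => bump N y * h y) = (fun y => (1 - (y / N) ^+ 2) * h y) \_ `[- N, N].
Proof.
apply/funext => y; rewrite /patch; case: ifPn.
  rewrite inE/= in_itv/= -ler_norml => yN; congr (_ * _).
  apply/max_idPl; rewrite subr_ge0 -real_normK ?num_real// expr_le1//.
  by rewrite normrM normfV (gtr0_norm N0) ler_pdivrMr// mul1r.
rewrite notin_setE/= in_itv/= -ler_norml => /negP; rewrite -ltNge => yN.
suff -> : bump N y = 0 by rewrite mul0r.
apply/max_idPr; rewrite subr_le0 -real_normK ?num_real// expr_ge1//.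
by rewrite normrM normfV (gtr0_norm N0) ler_pdivlMr// mul1r ltW.
Qed.

Lemma bump_ge0 y : 0 <= bump N y.
Proof. by rewrite le_max lexx orbT. Qed.

Let cpoly : continuous (fun y : R => 1 - (y / N) ^+ 2).
Proof.
move=> y; apply: cvgB; first exact: cvg_cst.
apply: (@continuous_comp R R R (fun y => y / N) (fun z => z ^+ 2)).
  by apply: mulrr_continuous.
exact: exprn_continuous.
Qed.

Lemma continuous_bump : continuous (bump N).
Proof.
move=> y; apply: (@continuous_max R R (fun y => 1 - (y / N) ^+ 2) (fun=> 0)).
  exact: cpoly.
exact: cst_continuous.
Qed.

Lemma measurable_bump : measurable_fun setT (bump N).
Proof. by apply: continuous_measurable_fun; exact: continuous_bump. Qed.

Lemma bump_le_indic y : bump N y <= \1_(`[- N, N]) y.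
Proof.
rewrite -[leLHS]mulr1; have := congr1 (fun f => f y) (bump_restrict (fun=> 1)).
move=> /= ->; rewrite /patch indicE; case: ifPn => // yN.
by rewrite mulr1 lerBlDr lerDl sqr_ge0.
Qed.

Lemma integrable_indicN : mu.-integrable setT (EFin \o \1_(`[- N, N])).
Proof.
apply: integrable_indic_lty => //=.
by rewrite lebesgue_measure_itv/= ifT ?ltry// lte_fin gtrN.
Qed.

Lemma integrable_bump (h : R -> R) : measurable_fun setT h ->
  (forall y, `|h y| <= 1) ->
  mu.-integrable setT (EFin \o (fun y => bump N y * h y)).
Proof.
move=> mh h1; apply: (integrable_le _ _ integrable_indicN).
  by apply: measurable_funM => //; exact: measurable_bump.
move=> y; apply: le_trans (bump_le_indic y).
by rewrite normrM (ger0_norm (bump_ge0 y)) ler_piMr// bump_ge0.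
Qed.

Lemma Rintegral_bump (h : R -> R) :
  Rintegral mu setT (fun y => bump N y * h y) =
  Rintegral mu `[- N, N] (fun y => (1 - (y / N) ^+ 2) * h y).
Proof. by rewrite [RHS]Rintegral_mkcond bump_restrict. Qed.

Let cscale b : continuous (fun y : R => b * y).
Proof. exact: mulrl_continuous. Qed.

Let csin b : continuous (fun y : R => sin (b * y)).
Proof.
move=> y; apply: (@continuous_comp R R R); first exact: cscale.
exact: continuous_sin.
Qed.

Let ccos b : continuous (fun y : R => cos (b * y)).
Proof.
move=> y; apply: (@continuous_comp R R R); first exact: cscale.
exact: continuous_cos.
Qed.

Lemma bump_sin b : Rintegral mu setT (fun y => bump N y * sin (b * y)) = 0.
Proof.
have [->|b0] := eqVneq b 0.
  under eq_Rintegral do rewrite mul0r sin0 mulr0.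
  by rewrite /Rintegral integral0.
pose F y := - ((1 - (y / N) ^+ 2) * (cos (b * y) / b)) -
   (2 * y / N ^+ 2 * (sin (b * y) / b ^+ 2)) - (2 / N ^+ 2) * (cos (b * y) / b ^+ 3).
rewrite Rintegral_bump; transitivity (F N - F (- N)); last first.
  by rewrite /F !mulrN cosN sinN; ring.
apply: Rintegral_FTC.
- by rewrite gtrN.
- move=> y; apply: cvgM; first exact: cpoly.
  exact: csin.
- move=> y; apply: is_derive_eq.
  rewrite /GRing.scale/=; field; by rewrite b0 gt_eqF.
Qed.

(** For small N b the trivial bound 2 N suffices.  Otherwise two integrations by
    parts gain 1 / (N b^2): the weight vanishes at both endpoints, so the first
    one leaves no boundary term. *)
Lemma bump_cos b :
  `|Rintegral mu setT (fun y => bump N y * cos (b * y))| <= bump_tail N b.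
Proof.
have D0 : 0 < 1 + (N * b) ^+ 2 by rewrite ltr_wpDr ?sqr_ge0.
have [Nb|Nb] := ltP (`|N * b|) 1.
  have le2N : `|Rintegral mu setT (fun y => bump N y * cos (b * y))| <= 2 * N.
    have -> : 2 * N = Rintegral mu setT \1_(`[- N, N]).
      rewrite /Rintegral integral_indic//= setIT lebesgue_measure_itv/= ifT/=.
        by rewrite opprK; ring.
      by rewrite lte_fin gtrN.
    apply: le_abs_Rintegral integrable_indicN.
      apply: measurable_funM; first exact: measurable_bump.
      by apply: continuous_measurable_fun; exact: ccos.
    move=> y; apply: le_trans (bump_le_indic y).
    by rewrite normrM (ger0_norm (bump_ge0 y)) ler_piMr ?bump_ge0// ler_norml cos_geN1 cos_le1.
  apply: (le_trans le2N); rewrite /bump_tail ler_pdivlMr//.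
  have : (N * b) ^+ 2 <= 1 by rewrite -real_normK ?num_real// expr_le1// ltW.
  move: ((N * b) ^+ 2) => t; rewrite -subr_ge0 => /(mulr_ge0 (ltW N0)).
  rewrite mulrBr mulr1 mulrDr mulr1 => ?.
  have := ltW N0; lra.
have b0 : b != 0 by apply: contraTneq Nb => ->; rewrite mulr0 normr0 -ltNge.
pose F y := (1 - (y / N) ^+ 2) * (sin (b * y) / b) -
   (2 * y / N ^+ 2 * (cos (b * y) / b ^+ 2)) + (2 / N ^+ 2) * (sin (b * y) / b ^+ 3).
have -> : Rintegral mu setT (fun y => bump N y * cos (b * y)) = F N - F (- N).
  rewrite Rintegral_bump; apply: Rintegral_FTC.
  - by rewrite gtrN.
  - move=> y; apply: cvgM; first exact: cpoly.
    exact: ccos.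
  - move=> y; apply: is_derive_eq.
    rewrite /GRing.scale/=; field; by rewrite b0 gt_eqF.
have -> : F N - F (- N) =
    4 * (N * b ^+ 2)^-1 * (sin (N * b) / (N * b) - cos (N * b)).
  rewrite /F !mulrN cosN sinN (mulrC b N); field; by rewrite b0 gt_eqF.
have Nb2 : 1 <= (N * b) ^+ 2 by rewrite -real_normK ?num_real// expr_ge1.
rewrite normrM (@ger0_norm _ (4 * _)); last first.
  by rewrite mulr_ge0// invr_ge0 mulr_ge0 ?sqr_ge0// ltW.
have -> : bump_tail N b = 4 * (N * b ^+ 2)^-1 * (4 * ((N * b) ^+ 2 / (1 + (N * b) ^+ 2))).
  rewrite /bump_tail; field; by rewrite b0 !gt_eqF.
apply: ler_wpM2l; first by rewrite mulr_ge0// invr_ge0 mulr_ge0 ?sqr_ge0// ltW.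
apply: (@le_trans _ _ 2).
  apply: (le_trans (ler_normB _ _)).
  have c1 : `|cos (N * b)| <= 1 by rewrite ler_norml cos_geN1 cos_le1.
  have s1 : `|sin (N * b) / (N * b)| <= 1.
    rewrite normrM normfV ler_pdivrMr ?mul1r; last by rewrite (lt_le_trans _ Nb).
    by apply: le_trans Nb; rewrite ler_norml sin_geN1 sin_le1.
  lra.
rewrite mulrA ler_pdivlMr//; lra.
Qed.

Lemma bump_tail_ge0 b : 0 <= bump_tail N b.
Proof. by rewrite divr_ge0 ?addr_ge0 ?sqr_ge0// mulr_ge0// ltW. Qed.

Lemma bump_tailN b : bump_tail N (- b) = bump_tail N b.
Proof. by rewrite /bump_tail mulrN sqrrN. Qed.

Lemma integral_oneDsqrV : (\int[mu]_y ((oneDsqr y)^-1)%:E = pi%:E :> \bar R)%E.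
Proof.
rewrite (@ge0_symfun_integralT R (fun y => (oneDsqr y)^-1)).
- have -> : [set x : R | 0 <= x] = `[0, +oo[%classic.
    by apply/seteqP; split=> x /=; rewrite in_itv/= andbT.
  by rewrite integral0y_oneDsqr -EFinM; congr EFin; rewrite mulrC divfK.
- by move=> x; rewrite invr_ge0.
- exact: continuous_oneDsqrV.
- by move=> x /=; rewrite /oneDsqr sqrrN.
Qed.

Lemma integral_bump_tail c :
  (\int[mu]_y (bump_tail N (2 * pi * (y + c)))%:E = 8%:E)%E.
Proof.
pose w : R := N * (2 * pi).
have w0 : 0 < w by rewrite !mulr_gt0// pi_gt0.
pose F y := w * (y + c).
have dF (y : R) : is_derive y 1 F w.
  by apply: is_derive_eq; rewrite /GRing.scale/= addr0 !mulr1.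
have F'E : F^`()%classic = cst w.
  by apply/funext => y; rewrite derive1E derive_val.
have := @increasing_ge0_integration_by_substitutionT R F (fun y => (oneDsqr y)^-1).
rewrite integral_oneDsqrV F'E => sub.
have {}sub : (\int[mu]_y ((oneDsqr (F y))^-1 * w)%:E = pi%:E)%E.
  apply/esym; apply: sub.
  - by move=> x y xy; rewrite /F ltr_pM2l// ltrD2r.
  - exact: cst_continuous.
  - exact: is_cvg_cst.
  - exact: is_cvg_cst.
  - by move=> x; exact: ex_derive.
  - by apply: gt0_cvgMrNy => //; exact: cvg_addrr_Ny.
  - by apply: gt0_cvgMry => //; exact: cvg_addrr.
  - exact: continuous_oneDsqrV.
  - by move=> x; rewrite invr_ge0.
have pi0 : pi != 0 :> R by rewrite gt_eqF// pi_gt0.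
transitivity (\int[mu]_y ((8 / pi)%:E * ((oneDsqr (F y))^-1 * w)%:E))%E.
  apply: eq_integral => y _; rewrite -EFinM; congr EFin.
  rewrite /bump_tail /oneDsqr /F /w.
  have -> : N * (2 * pi * (y + c)) = N * (2 * pi) * (y + c) by ring.
  move: pi0; move: (pi : R) => r r0; field; rewrite r0 andbT.
  set t := (X in 1 + X ^+ 2); have := sqr_ge0 t.
  by move: (t ^+ 2) => u u0; rewrite gt_eqF//; lra.
rewrite ge0_integralZl//.
- by rewrite sub -EFinM divfK.
- apply/measurable_EFinP; apply: measurable_funM => //.
  apply: continuous_measurable_fun => y.
  apply: (@continuous_comp R R R F (fun y => (oneDsqr y)^-1)); last exact: continuous_oneDsqrV.
  by apply: differentiable_continuous; apply/derivable1_diffP; exact: ex_derive.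
- by move=> y _; rewrite lee_fin mulr_ge0 ?invr_ge0// ltW.
- by rewrite lee_fin divr_ge0// pi_ge0.
Qed.

End bump.

(** * Bessel inequality for cosine and sine transforms *)
Section bessel.
Context {R : realType}.
Local Notation mu := (@lebesgue_measure R).

Definition trig (b : bool) (t : R) : R := if b then sin t else cos t.

Lemma trig_le1 b t : `|trig b t| <= 1.
Proof.
by case: b; rewrite ler_norml ?sin_geN1 ?sin_le1 ?cos_geN1 ?cos_le1.
Qed.

Lemma continuous_trig b : continuous (trig b).
Proof. by case: b => y; [exact: continuous_sin|exact: continuous_cos]. Qed.

Lemma measurable_trig b : measurable_fun setT (trig b).
Proof. by apply: continuous_measurable_fun; exact: continuous_trig. Qed.

Lemma dot2C (x y : R * R) : dot2 x y = dot2 y x.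
Proof. by rewrite /dot2 mulrC [x.2 * _]mulrC. Qed.

Lemma measurable_dot2 :
  measurable_fun setT (fun z : (measurableTypeR R * measurableTypeR R) *
    (measurableTypeR R * measurableTypeR R) => dot2 z.1 z.2).
Proof.
apply: measurable_funD; apply: measurable_funM.
- exact: (measurableT_comp measurable_fst measurable_fst).
- exact: (measurableT_comp measurable_fst measurable_snd).
- exact: (measurableT_comp measurable_snd measurable_fst).
- exact: (measurableT_comp measurable_snd measurable_snd).
Qed.

Definition wave b (z : (R * R) * (R * R)) : R := trig b (2 * pi * dot2 z.1 z.2).

Lemma measurable_wave b : measurable_fun setT (wave b :
  (measurableTypeR R * measurableTypeR R) *
  (measurableTypeR R * measurableTypeR R) -> R).
Proof.
apply: (measurableT_comp (measurable_trig b)).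
by apply: measurable_funM => //; exact: measurable_dot2.
Qed.

Lemma wave_le1 b z : `|wave b z| <= 1. Proof. exact: trig_le1. Qed.

Section weight.
Variable N : R.
Hypothesis N0 : 0 < N.

Definition bump2 (y : R * R) : R := bump N y.1 * bump N y.2.

Definition tail2 (x : R * R) : R :=
  bump_tail N (2 * pi * x.1) * bump_tail N (2 * pi * x.2).

Lemma integrable_bump2 : (@planar R).-integrable setT (EFin \o bump2).
Proof.
have bi : mu.-integrable setT (EFin \o bump N).
  rewrite (_ : bump N = (fun y => bump N y * cst 1 y)); last first.
    by apply/funext => y; rewrite mulr1.
  by apply: integrable_bump => // y; rewrite normr1.
exact: (integrable_prod bi bi).
Qed.

Lemma bump2_cos (c : R * R) :
  `|Rintegral (@planar R) setT (fun y => bump2 y * cos (2 * pi * dot2 c y))|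
  <= tail2 c.
Proof.
have isin (b : R) : mu.-integrable setT (EFin \o (fun y => bump N y * sin (b * y))).
  apply: integrable_bump => // [|y]; last by rewrite ler_norml sin_geN1 sin_le1.
  apply: (measurableT_comp (measurable_trig true)).
  exact: measurable_funM.
have icos (b : R) : mu.-integrable setT (EFin \o (fun y => bump N y * cos (b * y))).
  apply: integrable_bump => // [|y]; last by rewrite ler_norml cos_geN1 cos_le1.
  apply: (measurableT_comp (measurable_trig false)).
  exact: measurable_funM.
pose c1 := 2 * pi * c.1; pose c2 := 2 * pi * c.2.
have -> : Rintegral (@planar R) setT (fun y => bump2 y * cos (2 * pi * dot2 c y)) =
    Rintegral (@planar R) setT (fun y =>
      (bump N y.1 * cos (c1 * y.1)) * (bump N y.2 * cos (c2 * y.2)) -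
      (bump N y.1 * sin (c1 * y.1)) * (bump N y.2 * sin (c2 * y.2))).
  apply: eq_Rintegral => y _; rewrite /dot2 mulrDr !mulrA -/c1 -/c2 cosD /bump2.
  ring.
rewrite RintegralB//; [|exact: (integrable_prod (icos c1) (icos c2))|
  exact: (integrable_prod (isin c1) (isin c2))].
have prodE f g : mu.-integrable setT (EFin \o f) -> mu.-integrable setT (EFin \o g) ->
   Rintegral (@planar R) setT (fun z => f z.1 * g z.2) =
   Rintegral mu setT f * Rintegral mu setT g.
  by move=> fi gi; exact: Rintegral_prod.
rewrite (prodE _ _ (icos c1) (icos c2)) (prodE _ _ (isin c1) (isin c2)).
rewrite !bump_sin// mulr0 subr0 normrM.
by rewrite ler_pM// bump_cos.
Qed.

Lemma tail2_ge0 x : 0 <= tail2 x.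
Proof. by rewrite mulr_ge0// bump_tail_ge0. Qed.

(** The product-to-sum formulas turn the product of two waves, integrated against
    the weight, into cosine transforms at the difference and at the sum of the
    two points. *)
Definition schur_kernel (z : (R * R) * (R * R)) : R :=
  2^-1 * (tail2 (z.1 - z.2) + tail2 (z.1 + z.2)).

Lemma measurable_bump_tail : measurable_fun setT (bump_tail N).
Proof.
apply: continuous_measurable_fun => y.
apply: cvgM; first exact: cvg_cst.
apply: cvgV; first by rewrite gt_eqF// ltr_wpDr// sqr_ge0.
apply: cvgD; first exact: cvg_cst.
apply: (@continuous_comp R R R (fun b => N * b) (fun z => z ^+ 2)).
  exact: mulrl_continuous.
exact: exprn_continuous.
Qed.

Lemma measurable_schur_kernel : measurable_fun setT (schur_kernel :
  (measurableTypeR R * measurableTypeR R) *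
  (measurableTypeR R * measurableTypeR R) -> R).
Proof.
have m11 := measurableT_comp (@measurable_fst _ _ (measurableTypeR R) (measurableTypeR R))
  (@measurable_fst _ _ (measurableTypeR R * measurableTypeR R)%type
    (measurableTypeR R * measurableTypeR R)%type).
have m12 := measurableT_comp (@measurable_fst _ _ (measurableTypeR R) (measurableTypeR R))
  (@measurable_snd _ _ (measurableTypeR R * measurableTypeR R)%type
    (measurableTypeR R * measurableTypeR R)%type).
have m21 := measurableT_comp (@measurable_snd _ _ (measurableTypeR R) (measurableTypeR R))
  (@measurable_fst _ _ (measurableTypeR R * measurableTypeR R)%type
    (measurableTypeR R * measurableTypeR R)%type).
have m22 := measurableT_comp (@measurable_snd _ _ (measurableTypeR R) (measurableTypeR R))
  (@measurable_snd _ _ (measurableTypeR R * measurableTypeR R)%type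
    (measurableTypeR R * measurableTypeR R)%type).
apply: measurable_funM; first exact: measurable_cst.
apply: measurable_funD; apply: measurable_funM;
  apply: (measurableT_comp measurable_bump_tail);
  (apply: measurable_funM; first exact: measurable_cst).
- exact: (measurable_funB m11 m12).
- exact: (measurable_funB m21 m22).
- exact: (measurable_funD m11 m12).
- exact: (measurable_funD m21 m22).
Qed.

Lemma integral_schur_kernel x :
  (\int[@planar R]_x' (schur_kernel (x, x'))%:E = 64%:E)%E.
Proof.
have mt c : measurable_fun setT (fun y : measurableTypeR R => bump_tail N (2 * pi * (y + c))).
  apply: (measurableT_comp measurable_bump_tail); apply: measurable_funM => //.
  exact: measurable_funD.
have prodE c c' : (\int[@planar R]_y (bump_tail N (2 * pi * (y.1 + c)) *
    bump_tail N (2 * pi * (y.2 + c')))%:E = 64%:E)%E.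
  rewrite (fubini_tonelli1 (m1 := mu) (m2 := mu) (fun y => (bump_tail N (2 * pi * (y.1 + c)) *
    bump_tail N (2 * pi * (y.2 + c')))%:E)); last 2 first.
  - apply/measurable_EFinP; apply: measurable_funM.
      exact: (measurableT_comp (mt c) measurable_fst).
    exact: (measurableT_comp (mt c') measurable_snd).
  - by move=> y; rewrite lee_fin mulr_ge0// bump_tail_ge0.
  rewrite /fubini_F /=; under eq_integral => y _.
    under eq_integral do rewrite EFinM.
    rewrite ge0_integralZl//; [|by apply/measurable_EFinP; exact: (mt c')|
      by move=> z _; rewrite lee_fin bump_tail_ge0|by rewrite lee_fin bump_tail_ge0].
    rewrite integral_bump_tail//.
    over.
  rewrite ge0_integralZr//; [|by apply/measurable_EFinP; exact: (mt c)|
    by move=> z _; rewrite lee_fin bump_tail_ge0].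
  by rewrite integral_bump_tail// -EFinM; congr EFin; ring.
have tm c : measurable_fun setT (fun y : measurableTypeR R * measurableTypeR R =>
    (bump_tail N (2 * pi * (y.1 + c.1)) * bump_tail N (2 * pi * (y.2 + c.2)))%:E).
  apply/measurable_EFinP; apply: measurable_funM.
    exact: (measurableT_comp (mt c.1) measurable_fst).
  exact: (measurableT_comp (mt c.2) measurable_snd).
transitivity (\int[@planar R]_y ((2^-1)%:E *
   ((bump_tail N (2 * pi * (y.1 + (- x).1)) * bump_tail N (2 * pi * (y.2 + (- x).2)))%:E +
    (bump_tail N (2 * pi * (y.1 + x.1)) * bump_tail N (2 * pi * (y.2 + x.2)))%:E)))%E.
  apply: eq_integral => y _; rewrite -EFinD -EFinM /schur_kernel /tail2/=.
  rewrite -(bump_tailN N (2 * pi * (x.1 - y.1))) -(bump_tailN N (2 * pi * (x.2 - y.2))).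
  by rewrite -!mulrN !opprB [x.1 + _]addrC [x.2 + _]addrC.
have t0 c (y : measurableTypeR R * measurableTypeR R) :
  (0 <= (bump_tail N (2 * pi * (y.1 + c.1)) * bump_tail N (2 * pi * (y.2 + c.2)))%:E)%E.
  by rewrite lee_fin mulr_ge0// bump_tail_ge0.
rewrite ge0_integralZl; [|exact: measurableT|exact: emeasurable_funD|
  by move=> y _; rewrite adde_ge0|by rewrite lee_fin invr_ge0].
rewrite ge0_integralD//.
rewrite !prodE -EFinD -EFinM; congr EFin; lra.
Qed.

Lemma bessel_weighted b (g : R * R -> R) :
  (@planar R).-integrable setT (EFin \o g) ->
  (\int[@planar R]_y (bump2 y *
      (Rintegral (@planar R) setT (fun x => (g x * wave b (x, y))%R)) ^+ 2)%:E
   <= 64%:E * \int[@planar R]_x (g x ^+ 2)%:E)%E.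
Proof.
move=> gi; refine (@schur_test _ _ _ _ R planar planar (wave b) bump2
  schur_kernel 64 _ _ _ _ _ _ _ _ _ g gi).
- exact: measurable_wave.
- exact: wave_le1.
- by move=> y; rewrite mulr_ge0// bump_ge0.
- exact: integrable_bump2.
- exact: measurable_schur_kernel.
- by move=> z; rewrite mulr_ge0 ?invr_ge0// addr_ge0// tail2_ge0.
- move=> x x'; rewrite /schur_kernel/= [x + x']addrC; congr (_ * (_ + _)).
  rewrite /tail2/= -(bump_tailN N (2 * pi * (x.1 - x'.1))).
  by rewrite -(bump_tailN N (2 * pi * (x.2 - x'.2))) -!mulrN !opprB.
- move=> x x'.
  have bc (k : R) (c : R * R) : (@planar R).-integrable setT
      (EFin \o (fun y => k * (bump2 y * cos (2 * pi * dot2 c y)))).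
    have ci : (@planar R).-integrable setT
        (EFin \o (fun y => bump2 y * cos (2 * pi * dot2 c y))).
      apply: (integrable_le _ _ integrable_bump2).
        apply: measurable_funM.
          by apply/measurable_EFinP; exact: measurable_int integrable_bump2.
        exact: (measurableT_comp (measurable_wave false) (pair1_measurable c)).
      move=> y; rewrite normrM ger0_norm ?mulr_ge0 ?bump_ge0//.
      by rewrite ler_piMr ?mulr_ge0 ?bump_ge0// (trig_le1 false).
    have -> : EFin \o (fun y => k * (bump2 y * cos (2 * pi * dot2 c y))) =
        (fun y => k%:E * (bump2 y * cos (2 * pi * dot2 c y))%:E)%E.
      by apply/funext => y; rewrite /= EFinM.
    exact: integrableZl.
  have bc2 (k : R) (c : R * R) : Rintegral (@planar R) setT
      (fun y => k * (bump2 y * cos (2 * pi * dot2 c y))) =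
      k * Rintegral (@planar R) setT (fun y => bump2 y * cos (2 * pi * dot2 c y)).
    rewrite -RintegralZl//; have := bc 1 c.
    by under [X in EFin \o X]eq_fun do rewrite mul1r.
  pose s : R := if b then - 2^-1 else 2^-1.
  have -> : Rintegral (@planar R) setT (fun y => bump2 y * wave b (x, y) * wave b (x', y)) =
     Rintegral (@planar R) setT (fun y => 2^-1 * (bump2 y * cos (2 * pi * dot2 (x - x') y)) +
      s * (bump2 y * cos (2 * pi * dot2 (x + x') y))).
    apply: eq_Rintegral => y _.
    have -> : 2 * pi * dot2 (x - x') y = 2 * pi * dot2 x y - 2 * pi * dot2 x' y.
      by rewrite /dot2/=; ring.
    have -> : 2 * pi * dot2 (x + x') y = 2 * pi * dot2 x y + 2 * pi * dot2 x' y.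
      by rewrite /dot2/=; ring.
    rewrite cosB cosD /wave/= /s /trig.
    by case: (b); field.
  rewrite RintegralD// !bc2 /schur_kernel [leRHS]mulrDr.
  apply: le_trans (ler_normD _ _) _; rewrite !normrM.
  have h2 : `|2^-1 : R| = 2^-1 by rewrite ger0_norm// invr_ge0.
  have -> : `|s| = 2^-1 by rewrite /s; case: (b); rewrite ?normrN.
  by rewrite h2; apply: lerD; rewrite ler_pM2l ?invr_gt0//; exact: bump2_cos.
- by move=> x; rewrite integral_schur_kernel.
Qed.

End weight.

Lemma cvg_bump (y : R) : bump n.+1%:R y @[n --> \oo] --> (1 : R).
Proof.
have cv : y / n.+1%:R @[n --> \oo] --> (0 : R).
  by rewrite -[X in _ --> X](mulr0 y); apply: cvgMr; exact: cvg_harmonic.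
have : Num.max (1 - (y / n.+1%:R) ^+ 2) 0 @[n --> \oo] --> Num.max (1 - 0 ^+ 2) (0 : R).
  apply: (@cvg_comp _ _ _ (fun n => y / n.+1%:R) (fun z => Num.max (1 - z ^+ 2) 0) _ _ _ cv).
  have := @continuous_bump R 1 0.
  by rewrite /continuous_at /bump; under eq_fun do rewrite divr1; rewrite divr1.
by rewrite expr0n/= subr0 (max_idPl _).
Qed.

(** Half of Plancherel's theorem with a constant, obtained by letting the width
    of the weight tend to infinity in [bessel_weighted]: there the constant
    64 = 8^2 does not depend on the width. *)
Lemma bessel b (g : R * R -> R) :
  (@planar R).-integrable setT (EFin \o g) ->
  (\int[@planar R]_y
      ((Rintegral (@planar R) setT (fun x => (g x * wave b (x, y))%R)) ^+ 2)%:E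
   <= 64%:E * \int[@planar R]_x (g x ^+ 2)%:E)%E.
Proof.
move=> gi.
pose G y := Rintegral (@planar R) setT (fun x => g x * wave b (x, y)).
have mG : measurable_fun setT G.
  apply: (measurable_Rintegral_snd planar (f := fun z : (measurableTypeR R * measurableTypeR R) *
    (measurableTypeR R * measurableTypeR R) => g z.1 * wave b z)).
  apply: measurable_funM; last exact: measurable_wave.
  by apply: (measurableT_comp _ measurable_fst); apply/measurable_EFinP; exact: measurable_int gi.
pose h n (y : R * R) := (bump2 n.+1%:R y * G y ^+ 2)%:E.
have mh n : measurable_fun setT (h n : measurableTypeR R * measurableTypeR R -> \bar R).
  apply/measurable_EFinP; apply: measurable_funM; last exact: measurable_funX.
  by apply/measurable_EFinP; apply: measurable_int; exact: integrable_bump2.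
have h0 n y : (0 <= h n y)%E by rewrite lee_fin mulr_ge0 ?sqr_ge0// mulr_ge0 ?bump_ge0.
have hcvg y : h n y @[n --> \oo] --> (G y ^+ 2)%:E.
  apply: cvg_EFin; first by near=> n.
  have -> : G y ^+ 2 = 1 * 1 * G y ^+ 2 by rewrite !mul1r.
  by apply: cvgMl; apply: cvgM; exact: cvg_bump.
rewrite (_ : \int[_]_y _ = \int[planar]_y limn_einf (h ^~ y))%E; last first.
  apply: eq_integral => y _; have [-> _] := cvg_limn_einf_sup (hcvg y).
  by [].
apply: (le_trans (fatou planar measurableT mh (fun n y _ => h0 n y))).
rewrite limn_einf_lim; apply: lime_le; first exact: is_cvg_einfs.
apply: nearW => n; apply: le_trans (bessel_weighted (ltr0Sn R n) b gi).
by apply: ereal_inf_lbound; exists n => /=.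
Unshelve. all: by end_near. Qed.

End bessel.

(** * Dyadic chaining *)
Section dyadic_chaining.
Context {R : realType}.

Definition dyadic (k j : nat) : R := j%:R / 2 ^+ k.

Definition dyadic_below (s : R) (k : nat) : nat := Num.trunc (s * 2 ^+ k).

(** Discrete Cauchy-Schwarz for [a k = sqrt (w k) * (a k / sqrt (w k))]. *)
Lemma weighted_cauchy_schwarz (a w : nat -> R) n : (forall k, 0 < w k) ->
  (\sum_(k < n) a k) ^+ 2 <=
  (\sum_(k < n) w k) * (\sum_(k < n) (w k)^-1 * a k ^+ 2).
Proof.
move=> w0; elim: n => [|n IH]; first by rewrite !big_ord0 expr0n/= mul0r.
rewrite !big_ord_recr/=.
set A := \sum_(i < n) a i; set W := \sum_(i < n) w i.
set Q := \sum_(i < n) (w i)^-1 * a i ^+ 2.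
have W0 : 0 <= W by apply: sumr_ge0 => i _; exact: ltW.
have Q0 : 0 <= Q by apply: sumr_ge0 => i _; rewrite mulr_ge0 ?sqr_ge0// invr_ge0 ltW.
have wn := w0 n; move: IH; rewrite -/A -/W -/Q => IH.
have e : (W + w n) * (Q + (w n)^-1 * a n ^+ 2) =
    W * Q + (w n)^-1 * (w n ^+ 2 * Q + W * a n ^+ 2) + a n ^+ 2.
  by field; rewrite gt_eqF.
have amgm (X Y Z : R) : 0 <= X -> 0 <= Y -> Z ^+ 2 <= X * Y -> Z *+ 2 <= X + Y.
  move=> X0 Y0 ZXY; rewrite leNgt; apply/negP => h.
  have : (X + Y) ^+ 2 < (Z *+ 2) ^+ 2.
    have XY0 : 0 <= X + Y by rewrite addr_ge0.
    by rewrite ltr_pXn2r// nnegrE// (le_trans XY0)// ltW.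
  rewrite -mulr_natl => h2; have := sqr_ge0 (X - Y); nra.
rewrite e sqrrD lerD2r lerD// ler_pdivlMl// mulrnAr.
apply: amgm.
- by rewrite mulr_ge0 ?sqr_ge0.
- by rewrite mulr_ge0 ?sqr_ge0.
- rewrite !exprMn.
  have -> : w n ^+ 2 * Q * (W * a n ^+ 2) = w n ^+ 2 * (W * Q * a n ^+ 2) by ring.
  by rewrite ler_wpM2l ?sqr_ge0// ler_wpM2r ?sqr_ge0.
Qed.

Lemma dyadic_below_step s k : 0 <= s ->
  dyadic_below s k.+1 = (dyadic_below s k).*2 \/
  dyadic_below s k.+1 = (dyadic_below s k).*2.+1.
Proof.
move=> s0; rewrite /dyadic_below exprSr mulrA.
set x := s * 2 ^+ k; have x0 : 0 <= x by rewrite mulr_ge0// exprn_ge0.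
have /andP[h1 h2] := truncn_itv x0.
have [h|h] := ltP (x * 2) ((Num.trunc x).*2.+1)%:R; [left|right]; apply: truncn_def.
- rewrite h andbT -muln2 natrM; exact: ler_wpM2r.
- rewrite h/= -doubleS -muln2 natrM ltr_pM2r//.
Qed.

Lemma dyadic_double k j : dyadic k.+1 j.*2 = dyadic k j.
Proof. by rewrite /dyadic exprSr -muln2 natrM invfM mulrACA divff// mulr1. Qed.

Lemma cvg_dyadic_below s : 0 <= s ->
  dyadic k (dyadic_below s k) @[k --> \oo] --> s.
Proof.
move=> s0; apply: (squeeze_cvgr (f := fun k => s - 2^-1 ^+ k) (h := fun=> s)).
- apply: nearW => k; rewrite /dyadic ler_pdivrMr ?exprn_gt0// truncn_le.
  rewrite mulr_ge0 ?exprn_ge0//= andbT lerBlDr exprVn.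
  rewrite -[X in _ + X]mul1r -mulrDl natr1 ler_pdivlMr ?exprn_gt0// ltW//.
  exact: truncnS_gt.
- rewrite -[X in _ --> X]subr0; apply: cvgB; first exact: cvg_cst.
  by apply: cvg_expr; rewrite ger0_norm ?invr_ge0// invf_lt1// ltr1n.
- exact: cvg_cst.
Qed.

Lemma dyadic_below_le s k : 0 <= s -> 0 <= dyadic k (dyadic_below s k) <= s.
Proof.
move=> s0; rewrite divr_ge0 ?exprn_ge0//= ler_pdivrMr ?exprn_gt0//.
by rewrite truncn_le mulr_ge0// exprn_ge0.
Qed.

(** At k = 0 the values of F at the integers replace the increments: they are
    the starting points of the chains, and bounding their squares in the same
    way as those of the increments allows a uniform treatment of all levels. *)
Definition increment (F : R -> R) (k j : nat) : R :=
  if k is 0 then F j%:R else F (dyadic k j.+1) - F (dyadic k j).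

(** F at the n-th dyadic approximation of s telescopes over the levels k <= n.  By
    [dyadic_below_step] each step is zero or one of the increments at its level,
    so its square is at most the sum over all increments of that level;
    [weighted_cauchy_schwarz] with weights rho^k adds up the levels. *)
Lemma chaining (F : R -> R) (rho s : R) n : 0 < rho < 1 -> 0 <= s ->
  ((F (dyadic n (dyadic_below s n)) ^+ 2)%:E <=
   ((1 - rho)^-1)%:E *
   \sum_(k <oo) \sum_(j <oo) ((rho ^+ k)^-1 * increment F k j ^+ 2)%:E)%E.
Proof.
move=> /andP[rho0 rho1] s0.
pose f k := F (dyadic k (dyadic_below s k)).
pose d k := if k is k'.+1 then f k'.+1 - f k' else f 0%N.
have fE m : f m = \sum_(k < m.+1) d k.
  elim: m => [|m IH]; first by rewrite big_ord1.
  by rewrite big_ord_recr/= -IH addrC subrK.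
have inc0 k j : (0 <= ((rho ^+ k)^-1 * increment F k j ^+ 2)%:E)%E.
  by rewrite lee_fin mulr_ge0 ?sqr_ge0// invr_ge0 exprn_ge0 ?ltW.
have incS k : (((rho ^+ k)^-1 * d k ^+ 2)%:E <=
    \sum_(j <oo) ((rho ^+ k)^-1 * increment F k j ^+ 2)%:E)%E.
  have single j : (((rho ^+ k)^-1 * increment F k j ^+ 2)%:E <=
      \sum_(j <oo) ((rho ^+ k)^-1 * increment F k j ^+ 2)%:E)%E.
    apply: le_trans (nneseries_lim_ge j.+1 _); last by move=> *.
    by rewrite big_mkord big_ord_recr/= leeDr// sume_ge0.
  case: k single => [|k] single.
    by move: (single (dyadic_below s 0)); rewrite /= /f /dyadic expr0 divr1.
  have [e|e] := dyadic_below_step k s0.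
    rewrite /d /f e dyadic_double subrr expr0n mulr0.
    exact: nneseries_ge0.
  apply: le_trans (single (dyadic_below s k).*2).
  by rewrite /increment /d /f e dyadic_double.
have geo : \sum_(k < n.+1) rho ^+ k <= (1 - rho)^-1.
  have := @geometric_le_lim R n.+1 1 rho ler01 rho0.
  rewrite (gtr0_norm rho0) mul1r => /(_ rho1); apply: le_trans.
  by rewrite /series/= big_mkord; apply: ler_sum => i _; rewrite mul1r.
have wcs := @weighted_cauchy_schwarz d (fun k => rho ^+ k) n.+1 (fun k => exprn_gt0 k rho0).
rewrite -/(f n) fE; apply: (@le_trans _ _
  ((1 - rho)^-1 * (\sum_(k < n.+1) (rho ^+ k)^-1 * d k ^+ 2))%:E).
  rewrite lee_fin; apply: (le_trans wcs); apply: ler_wpM2r => //.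
  by apply: sumr_ge0 => k _; rewrite mulr_ge0 ?sqr_ge0// invr_ge0 exprn_ge0 ?ltW.
rewrite EFinM lee_pmul2l//; last by rewrite lte_fin invr_gt0 subr_gt0.
rewrite -sumEFin.
apply: le_trans (nneseries_lim_ge n.+1 _); last first.
  by move=> k _ _; apply: nneseries_ge0 => *; exact: inc0.
by rewrite big_mkord; apply: lee_sum => k _; exact: incS.
Qed.

End dyadic_chaining.

(** * Maximal inequalities from the increments of a multiplier *)
Section half_maximal.
Context {R : realType}.
Local Notation plane := (measurableTypeR R * measurableTypeR R)%type.

Lemma nneseries_le (f : nat -> \bar R) (b : \bar R) : (forall n, 0 <= f n)%E ->
  (forall n, (\sum_(i < n) f i <= b)%E) -> (\sum_(i <oo) f i <= b)%E.
Proof.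
move=> f0 fb; apply: lime_le; first exact: is_cvg_nneseries.
by apply: nearW => n; rewrite big_mkord.
Qed.

(** A multiplier operator in real form: [m] is the multiplier at a fixed scale,
    [h] one of the real components of a Fourier transform, and [b] selects the
    component of the exponential. *)
Definition wave_integral (b : bool) (m h : R * R -> R) (x : R * R) : R :=
  Rintegral (@planar R) setT (fun xi => m xi * h xi * wave b (xi, x)).

Variables (u : R -> R * R -> R) (C rho : R) (h : R * R -> R) (M : R) (b : bool).
Hypothesis rho01 : 0 < rho < 1.
Hypothesis C0 : 0 < C.
Hypothesis mu_ : forall s, measurable_fun setT (u s : plane -> R).
(** Domination on bounded ranges of s is what dominated convergence needs; the
    last hypothesis on [u] carries the maximal estimate. *)
Hypothesis udom : forall S, exists2 Phi : R * R -> R,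
  (@planar R).-integrable setT (EFin \o Phi) &
  forall s xi, 0 <= s <= S -> `|u s xi| <= Phi xi.
Hypothesis ucont : forall xi, continuous (u ^~ xi).
Hypothesis uvar : forall xi k n,
  \sum_(j < n) increment (u ^~ xi) k j ^+ 2 <= C * (rho ^+ k) ^+ 2.
Hypothesis mh : measurable_fun setT (h : plane -> R).
Hypothesis hM : forall xi, `|h xi| <= M.

Let U s x := wave_integral b (u s) h x.

Let M0 : 0 <= M. Proof. exact: le_trans (hM point). Qed.

Let iM (Phi : R * R -> R) : (@planar R).-integrable setT (EFin \o Phi) ->
  (@planar R).-integrable setT (EFin \o (fun xi => Phi xi * M)).
Proof.
move=> iPhi.
have -> : EFin \o (fun xi => Phi xi * M) = (fun xi => (EFin \o Phi) xi * M%:E)%E.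
  by apply/funext => xi /=; rewrite EFinM.
exact: integrableZr.
Qed.

Let mwave x : measurable_fun setT (fun xi : plane => wave b (xi, x)).
Proof. exact: (measurableT_comp (measurable_wave b) (pair2_measurable x)). Qed.

Let iuh s : 0 <= s ->
  (@planar R).-integrable setT (EFin \o (fun xi => u s xi * h xi)).
Proof.
move=> s0; have [Phi iPhi Phiu] := udom s.
apply: (integrable_le _ _ (iM iPhi)); first exact: measurable_funM.
by move=> xi; rewrite normrM ler_pM// Phiu// s0 lexx.
Qed.

Let iuhw s x : 0 <= s ->
  (@planar R).-integrable setT (EFin \o (fun xi => u s xi * h xi * wave b (xi, x))).
Proof.
move=> s0; have [Phi iPhi Phiu] := udom s.
apply: (integrable_le _ _ (iM iPhi)).
  by apply: measurable_funM => //; exact: measurable_funM.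
move=> xi; rewrite 2!normrM -[leRHS]mulr1 ler_pM ?wave_le1//.
by rewrite ler_pM// Phiu// s0 lexx.
Qed.

Let dyadic_ge0 k j : 0 <= dyadic k j :> R.
Proof. by rewrite divr_ge0// exprn_ge0. Qed.

(** Increments in s commute with the integral, so every increment of the
    operator is an operator of the same form, to which [bessel] applies. *)
Let incU k j x : increment (U ^~ x) k j =
  Rintegral (@planar R) setT
    (fun xi => increment (u ^~ xi) k j * h xi * wave b (xi, x)).
Proof.
case: k => [|k] //=; rewrite -RintegralB//; [|exact: iuhw|exact: iuhw].
by apply: eq_Rintegral => xi _; rewrite !mulrBl.
Qed.

Let minc k j : measurable_fun setT (fun xi : plane => increment (u ^~ xi) k j).
Proof. by case: k => [|k] //=; exact: measurable_funB. Qed.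

Let iinc k j : (@planar R).-integrable setT
  (EFin \o (fun xi => increment (u ^~ xi) k j * h xi)).
Proof.
case: k => [|k] /=; first exact: iuh.
have -> : EFin \o (fun xi => (u (dyadic k.+1 j.+1) xi - u (dyadic k.+1 j) xi) * h xi) =
   ((EFin \o (fun xi => u (dyadic k.+1 j.+1) xi * h xi)%R) \-
    (EFin \o (fun xi => u (dyadic k.+1 j) xi * h xi)%R))%E.
  by apply/funext => xi /=; rewrite mulrBl EFinB.
by apply: integrableB => //; exact: iuh.
Qed.

Let mincU k j : measurable_fun setT (fun x : plane => increment (U ^~ x) k j).
Proof.
under eq_fun do rewrite incU.
apply: (measurable_Rintegral_snd planar (f := fun z : plane * plane =>
   increment (u ^~ z.1) k j * h z.1 * wave b z)).
apply: measurable_funM; last exact: measurable_wave.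
exact: (measurableT_comp (measurable_funM (minc k j) mh) measurable_fst).
Qed.

Let cvgU s x : 0 <= s ->
  U (dyadic k (dyadic_below s k)) x @[k --> \oo] --> U s x.
Proof.
move=> s0; have [Phi iPhi Phiu] := udom s.
pose g k xi := (u (dyadic k (dyadic_below s k)) xi * h xi * wave b (xi, x))%:E.
have mg k : measurable_fun setT (g k : plane -> \bar R).
  apply/measurable_EFinP; apply: measurable_funM => //; exact: measurable_funM.
have [||||_ _ cvgI] := @dominated_convergence _ _ _ (@planar R) setT measurableT g
   (fun xi => (u s xi * h xi * wave b (xi, x))%:E) (EFin \o (fun xi => Phi xi * M)) mg.
- by apply/measurable_EFinP; apply: measurable_funM => //; exact: measurable_funM.
- apply: aeW => xi _; apply: cvg_EFin; first by near=> k.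
  apply: cvgMl; apply: cvgMl.
  apply: (@cvg_comp _ _ _ _ (u ^~ xi) _ _ _ (cvg_dyadic_below s0)).
  exact: ucont.
- exact: iM.
- apply: aeW => xi k _; rewrite lee_fin 2!normrM -[leRHS]mulr1 ler_pM ?wave_le1//.
  by rewrite ler_pM// Phiu// dyadic_below_le.
have -> : U s x = fine (\int[@planar R]_xi (u s xi * h xi * wave b (xi, x))%:E)%E by [].
apply: fine_cvg; rewrite fineK; last exact: (integrable_fin_num measurableT (iuhw x s0)).
exact: cvgI.
Unshelve. all: by end_near. Qed.

Let inc0 (F : R -> R) k j : (0 <= ((rho ^+ k)^-1 * increment F k j ^+ 2)%:E)%E.
Proof.
have /andP[r0 _] := rho01.
by rewrite lee_fin mulr_ge0 ?sqr_ge0// invr_ge0 exprn_ge0 ?ltW.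
Qed.

Let Q x := (\sum_(k <oo) \sum_(j <oo)
  ((rho ^+ k)^-1 * increment (U ^~ x) k j ^+ 2)%:E)%E.

Let mQk k : measurable_fun setT (fun x : plane => \sum_(j <oo)
  ((rho ^+ k)^-1 * increment (U ^~ x) k j ^+ 2)%:E)%E.
Proof.
apply: ge0_emeasurable_sum => j; first by move=> *; exact: inc0.
move=> _; apply/measurable_EFinP; apply: measurable_funM => //.
by apply: measurable_funX; exact: mincU.
Qed.

Let Ih := (\int[@planar R]_xi (h xi ^+ 2)%:E)%E.

Let Ih0 : (0 <= Ih)%E.
Proof. by apply: integral_ge0 => xi _; rewrite lee_fin sqr_ge0. Qed.

(** After [bessel], the sum over j is taken inside the integral over the
    frequencies, where the hypothesis on the increments of [u] applies pointwise. *)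
Let level k : (\sum_(j <oo) \int[@planar R]_x
   (increment (U ^~ x) k j ^+ 2)%:E <= (64 * C * (rho ^+ k) ^+ 2)%:E * Ih)%E.
Proof.
apply: nneseries_le => [j|n].
  by apply: integral_ge0 => x _; rewrite lee_fin sqr_ge0.
have step j : (\int[@planar R]_x (increment (U ^~ x) k j ^+ 2)%:E <=
    64%:E * \int[@planar R]_xi ((increment (u ^~ xi) k j * h xi) ^+ 2)%:E)%E.
  under eq_integral do rewrite incU.
  exact: bessel (iinc k j).
have m2 j : measurable_fun setT (fun xi : plane => ((increment (u ^~ xi) k j * h xi) ^+ 2)%:E).
  by apply/measurable_EFinP; apply: measurable_funX; exact: measurable_funM.
apply: (@le_trans _ _ (\sum_(j < n) 64%:E *
    \int[@planar R]_xi ((increment (u ^~ xi) k j * h xi) ^+ 2)%:E)%E).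
  by apply: lee_sum => j _; exact: step.
rewrite -ge0_sume_distrr; last first.
  by move=> j _; apply: integral_ge0 => xi _; rewrite lee_fin sqr_ge0.
rewrite -ge0_integral_sum//; last by move=> j xi _; rewrite lee_fin sqr_ge0.
rewrite -mulrA EFinM -muleA lee_pmul2l// -ge0_integralZl; last 4 first.
- exact: measurableT.
- by apply/measurable_EFinP; exact: measurable_funX.
- by move=> xi _; rewrite lee_fin sqr_ge0.
- by rewrite lee_fin mulr_ge0 ?sqr_ge0// ltW.
apply: ge0_le_integral => //.
- by move=> xi _; apply: sume_ge0 => j _; rewrite lee_fin sqr_ge0.
- exact: emeasurable_sum.
- by apply/measurable_EFinP; apply: measurable_funM => //; exact: measurable_funX.
- move=> xi _; rewrite sumEFin lee_fin.
  under eq_bigr do rewrite exprMn.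
  by rewrite -mulr_suml ler_wpM2r ?sqr_ge0.
Qed.

(** The majorant G is the right-hand side of [chaining] for the operator at x; it
    bounds the square at every s by continuity in s, since [chaining] bounds it at
    the dyadic approximations.  Its level k contributes rho^-k rho^(2k) = rho^k to
    the integral, which explains the second geometric factor.  A measurable
    majorant stands in for the supremum over the uncountable set of scales. *)
Lemma half_maximal :
  let W := (1 - rho)^-1 in
  exists G : plane -> \bar R, [/\ measurable_fun setT G,
    forall x, (0 <= G x)%E,
    forall s x, 0 <= s -> ((wave_integral b (u s) h x ^+ 2)%:E <= G x)%E &
    (\int[@planar R]_x G x <= (W * (W * (64 * C)))%:E *
       \int[@planar R]_xi (h xi ^+ 2)%:E)%E].
Proof.
move=> W; have /andP[r0 r1] := rho01.
have W0 : 0 < W by rewrite invr_gt0 subr_gt0.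
have Qk0 x k : (0 <= \sum_(j <oo) ((rho ^+ k)^-1 * increment (U ^~ x) k j ^+ 2)%:E)%E.
  by apply: nneseries_ge0 => *; exact: inc0.
have Q0 x : (0 <= Q x)%E by apply: nneseries_ge0.
have mQ : measurable_fun setT (Q : plane -> \bar R) by exact: ge0_emeasurable_sum.
exists (fun x => W%:E * Q x)%E; split.
- exact: emeasurable_funM.
- by move=> x; rewrite mule_ge0// lee_fin ltW.
- move=> s x s0; have cU := @cvgU s x s0.
  have cU2 : (U (dyadic k (dyadic_below s k)) x ^+ 2)%:E @[k --> \oo] --> (U s x ^+ 2)%:E.
    apply: cvg_EFin; first by near=> k.
    apply: (@cvg_comp _ _ _ (fun k => U (dyadic k (dyadic_below s k)) x)
      (fun z => z ^+ 2) _ _ _ cU); exact: exprn_continuous.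
  rewrite -(cvg_lim _ cU2)//; apply: lime_le; first by apply/cvg_ex; eexists; exact: cU2.
  by apply: nearW => k; exact: (chaining (U ^~ x) k rho01 s0).
rewrite ge0_integralZl//; last by rewrite lee_fin ltW.
rewrite EFinM -muleA lee_pmul2l//.
rewrite integral_nneseries//.
have [Ioo|Ifin] := eqVneq Ih +oo%E.
  by rewrite -/Ih Ioo gt0_muley ?leey// lte_fin !mulr_gt0.
have {}Ifin : Ih \is a fin_num by rewrite ge0_fin_numE// ltey.
apply: nneseries_le => [k|n]; first by apply: integral_ge0.
apply: (@le_trans _ _ (\sum_(k < n) (rho ^+ k * (64 * C))%:E * Ih)%E).
  apply: lee_sum => k _; rewrite integral_nneseries//; last first.
    move=> j; apply/measurable_EFinP; apply: measurable_funM => //.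
    by apply: measurable_funX; exact: mincU.
  have rk0 : 0 < rho ^+ k by rewrite exprn_gt0.
  rewrite [leLHS](_ : _ = ((rho ^+ k)^-1)%:E *
     \sum_(j <oo) \int[@planar R]_x (increment (U ^~ x) k j ^+ 2)%:E)%E; last first.
    rewrite -nneseriesZl; last first.
      by move=> j _; apply: integral_ge0 => x _; rewrite lee_fin sqr_ge0.
    apply: eq_eseriesr => j _; under eq_integral do rewrite EFinM.
    rewrite ge0_integralZl//.
    + by apply/measurable_EFinP; apply: measurable_funX; exact: mincU.
    + by move=> x _; rewrite lee_fin sqr_ge0.
    + by rewrite lee_fin invr_ge0 ltW.
  rewrite lee_pdivrMl// muleA -EFinM.
  apply: le_trans (level k) _; rewrite lee_wpmul2r// lee_fin le_eqVlt.
  by apply/orP; left; apply/eqP; ring.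
rewrite -ge0_sume_distrl; last first.
  by move=> k _; rewrite lee_fin !mulr_ge0 ?exprn_ge0 ?(ltW C0) ?(ltW r0).
rewrite lee_wpmul2r// sumEFin lee_fin -mulr_suml ler_wpM2r ?mulr_ge0 ?(ltW C0)//.
have := @geometric_le_lim R n 1 rho ler01 r0.
rewrite (gtr0_norm r0) mul1r => /(_ r1); apply: le_trans.
by rewrite /series/= big_mkord; apply: ler_sum => i _; rewrite mul1r.
Unshelve. all: by end_near. Qed.

End half_maximal.

Section maximal_multipliers.
Context {R : realType}.
Local Notation plane := (measurableTypeR R * measurableTypeR R)%type.

(** The conclusion asks for a measurable majorant rather than for a bound on the
    supremum over t, whose measurability would need a separate proof; majorants
    can be added, which is how operators are combined below. *)
Definition maximal_multiplier (m : R * R -> R) (C : R) : Prop :=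
  [/\ forall t, measurable_fun setT ((fun xi => m (expR t *: xi)) : plane -> R),
    forall t, exists2 Phi : R * R -> R, (@planar R).-integrable setT (EFin \o Phi) &
      forall xi, `|m (expR t *: xi)| <= Phi xi &
    forall (b : bool) (h : R * R -> R) Mh,
      measurable_fun setT (h : plane -> R) -> (forall xi, `|h xi| <= Mh) ->
      exists G : plane -> \bar R, [/\ measurable_fun setT G,
        forall x, (0 <= G x)%E,
        forall t x, ((wave_integral b (fun xi => m (expR t *: xi)) h x ^+ 2)%:E <= G x)%E &
        (\int[@planar R]_x G x <= C%:E * \int[@planar R]_xi (h xi ^+ 2)%:E)%E]].

Lemma maximal_multiplier_le m C C' : C <= C' ->
  maximal_multiplier m C -> maximal_multiplier m C'.
Proof.
move=> CC' [mm dom Gm]; split=> // b h Mh mh hM.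
have [G [mG G0 Gs GI]] := Gm b h Mh mh hM.
exists G; split=> //; apply: (le_trans GI); rewrite lee_wpmul2r ?lee_fin//.
by apply: integral_ge0 => xi _; rewrite lee_fin sqr_ge0.
Qed.

End maximal_multipliers.

(** * Variation of finite sequences *)
Section variation.
Context {R : realType}.
Implicit Types (a b x : nat -> R).

Definition monotone_seq x :=
  (forall j, x j <= x j.+1) \/ (forall j, x j.+1 <= x j).

Definition variation (n : nat) x : R := \sum_(j < n) `|x j.+1 - x j|.

Lemma variation_mul n a b A B : (forall j, `|a j| <= A) -> (forall j, `|b j| <= B) ->
  variation n (fun j => a j * b j) <= A * variation n b + B * variation n a.
Proof.
move=> aA bB; rewrite /variation !mulr_sumr -big_split/=; apply: ler_sum => j _.
have -> : a j.+1 * b j.+1 - a j * b j =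
  a j.+1 * (b j.+1 - b j) + b j * (a j.+1 - a j) by ring.
by apply: le_trans (ler_normD _ _) _; rewrite !normrM lerD// ler_wpM2r.
Qed.

Lemma variation_lipschitz n a x L : (forall j, `|a j.+1 - a j| <= L * `|x j.+1 - x j|) ->
  variation n a <= L * variation n x.
Proof. by move=> aL; rewrite /variation mulr_sumr; apply: ler_sum => j _. Qed.

Lemma variation_monotone n x lo hi : monotone_seq x ->
  (forall j, lo <= x j <= hi) -> variation n x <= hi - lo.
Proof.
move=> mx xlh; have /andP[l0 h0] := xlh 0%N; have /andP[ln hn] := xlh n.
case: mx => mx.
  rewrite /variation (eq_bigr (fun j : 'I_n => x j.+1 - x j)); last first.
    by move=> j _; rewrite ger0_norm// subr_ge0.
  rewrite -(big_mkord xpredT (fun j => x j.+1 - x j)) telescope_sumr// lerB//.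
rewrite /variation (eq_bigr (fun j : 'I_n => - (x j.+1 - x j))); last first.
  by move=> j _; rewrite ler0_norm// subr_le0.
by rewrite sumrN -(big_mkord xpredT (fun j => x j.+1 - x j)) telescope_sumr// opprB lerB.
Qed.

(** How smallness and bounded variation combine: this is the gain of a power of
    the mesh in the sum of squared increments. *)
Lemma variation_sqr n x H : (forall j, `|x j.+1 - x j| <= H) ->
  \sum_(j < n) (x j.+1 - x j) ^+ 2 <= H * variation n x.
Proof.
move=> xH; rewrite /variation mulr_sumr; apply: ler_sum => j _.
by rewrite -real_normK ?num_real// expr2 ler_wpM2r.
Qed.

Definition clamp (lo hi t : R) : R := Num.max lo (Num.min hi t).

Lemma clamp_itv lo hi t : lo <= hi -> lo <= clamp lo hi t <= hi.
Proof. by move=> lh; rewrite le_max lexx/= ge_max lh ge_min lexx. Qed.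

Lemma clamp_id lo hi t : lo <= t <= hi -> clamp lo hi t = t.
Proof. by move=> /andP[lt th]; rewrite /clamp (min_idPr th) (max_idPr lt). Qed.

Lemma clamp_lo lo hi t : t <= lo -> lo <= hi -> clamp lo hi t = lo.
Proof. by move=> tl lh; rewrite /clamp (min_idPr (le_trans tl lh)) (max_idPl tl). Qed.

Lemma clamp_hi lo hi t : hi <= t -> lo <= hi -> clamp lo hi t = hi.
Proof. by move=> ht lh; rewrite /clamp (min_idPl ht) (max_idPr lh). Qed.

Lemma le_clamp lo hi : {homo clamp lo hi : s t / s <= t}.
Proof.
move=> s t st; rewrite /clamp ge_max !le_max lexx/=.
by apply/orP; right; rewrite le_min !ge_min st lexx !orbT.
Qed.

Lemma monotone_clamp lo hi x : monotone_seq x -> monotone_seq (fun j => clamp lo hi (x j)).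
Proof. by move=> [mx|mx]; [left|right] => j; exact: le_clamp. Qed.

Lemma clamp_dist lo hi s t : s <= t -> clamp lo hi t - clamp lo hi s <= t - s.
Proof.
move=> st; rewrite /clamp; case: (leP hi t); case: (leP hi s) => hs ht;
  rewrite ?maxEle; repeat case: ifPn; rewrite -?ltNge => *; lra.
Qed.

End variation.

(** * Hoelder continuity of powers *)
Section powers.
Context {R : realType}.

(** With x normalized to 1, both y / x and (x - y) / x lie in [0, 1], where
    t <= t `^ mu; and these two numbers add up to 1. *)
Lemma powR_subadditive (x y mu : R) : 0 < mu <= 1 -> 0 <= y <= x ->
  x `^ mu - y `^ mu <= (x - y) `^ mu.
Proof.
move=> /andP[mu0 mu1] /andP[y0 yx].
have [x0|x0] := leP x 0.
  have -> : x = 0 by apply/le_anti; rewrite x0 (le_trans y0).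
  by rewrite powR0 ?gt_eqF// sub0r (le_trans _ (powR_ge0 _ _))// oppr_le0 powR_ge0.
have frac t : 0 <= t <= 1 -> t <= t `^ mu.
  move=> /andP[t0 t1]; move: t0; rewrite le_eqVlt => /predU1P[<-|t0].
    exact: powR_ge0.
  by apply: ger1_powR => //; rewrite t0.
have x0' := ltW x0; have xy0 : 0 <= x - y by rewrite subr_ge0.
have h1 : y / x <= (y / x) `^ mu.
  by apply: frac; rewrite divr_ge0//= ler_pdivrMr ?mul1r.
have h2 : (x - y) / x <= ((x - y) / x) `^ mu.
  by apply: frac; rewrite divr_ge0//= ler_pdivrMr ?mul1r// gerBl.
have xmu : 0 < x `^ mu by rewrite powR_gt0.
rewrite lerBlDr -[leLHS]mul1r.
have -> : y `^ mu = (y / x) `^ mu * x `^ mu.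
  by rewrite -powRM ?divr_ge0// divfK ?gt_eqF.
have -> : (x - y) `^ mu = ((x - y) / x) `^ mu * x `^ mu.
  by rewrite -powRM ?divr_ge0// divfK ?gt_eqF.
rewrite -mulrDl ler_pM2r//.
apply: le_trans (lerD h2 h1); rewrite -mulrDl subrK divff ?gt_eqF//.
Qed.

Lemma powR_holder_le1 (x y mu : R) : 0 < mu <= 1 -> 0 <= x -> 0 <= y ->
  `|x `^ mu - y `^ mu| <= `|x - y| `^ mu.
Proof.
move=> mu01 + +; wlog yx : x y / y <= x.
  move=> W x0 y0; have [yx|/ltW xy] := leP y x; first exact: W.
  by rewrite distrC [`|x - y|]distrC; exact: W.
move=> x0 y0; have /andP[mu0 _] := mu01.
rewrite !ger0_norm ?subr_ge0//; first by apply: powR_subadditive => //; rewrite y0.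
by apply: ge0_ler_powR => //; exact: ltW.
Qed.

(** For exponents above 1 write lam = N mu with an integer N > lam, so that
    [x `^ lam] is the N-th power, Lipschitz on bounded sets, of a Hoelder
    continuous function. *)
Lemma powR_holder (lam P : R) : 0 < lam -> 0 <= P -> exists mu H : R,
  [/\ 0 < mu, mu <= 1, 0 <= H & forall x y, 0 <= x <= P -> 0 <= y <= P ->
    `|x `^ lam - y `^ lam| <= H * `|x - y| `^ mu].
Proof.
move=> lam0 P0; pose N := (Num.trunc lam).+1; pose mu := lam / N%:R.
have N0 : 0 < N%:R :> R by rewrite ltr0n.
have mu0 : 0 < mu by rewrite divr_gt0.
have mu1 : mu <= 1 by rewrite ler_pdivrMr// mul1r ltW// truncnS_gt.
pose Pm := P `^ mu; have Pm0 : 0 <= Pm by exact: powR_ge0.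
exists mu, (N%:R * Pm ^+ N.-1); split=> //.
  by rewrite mulr_ge0 ?ler0n// exprn_ge0.
move=> x y /andP[x0 xP] /andP[y0 yP].
have powE z : 0 <= z -> z `^ lam = (z `^ mu) ^+ N.
  by move=> z0; rewrite -powR_mulrn ?powR_ge0// -powRrM divfK// gt_eqF.
have le_Pm z : 0 <= z -> z <= P -> z `^ mu <= Pm.
  by move=> z0 zP; apply: ge0_ler_powR => //; exact: ltW.
rewrite !powE// subrXX normrM mulrC ler_pM//; last first.
  by apply: powR_holder_le1 => //; rewrite mu0.
apply: le_trans (ler_norm_sum _ _ _) _.
rewrite mulr_natl -[X in _ *+ X]card_ord -sumr_const; apply: ler_sum => i _.
have -> : Pm ^+ N.-1 = Pm ^+ (N.-1 - i) * Pm ^+ i.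
  by rewrite -exprD subnK// -ltnS prednK.
rewrite ger0_norm ?mulr_ge0 ?exprn_ge0 ?powR_ge0//.
by rewrite ler_pM ?exprn_ge0 ?powR_ge0//; apply: lerXn2r; rewrite ?nnegrE ?powR_ge0// le_Pm.
Qed.

End powers.

(** * Continuing the phase by its tangents *)
Lemma cvg_dnbhs_left_right {R : realType} (f : R -> R) (t l : R) :
  f s @[s --> t^'+] --> l -> f s @[s --> t^'-] --> l -> f s @[s --> t^'] --> l.
Proof.
move=> fr fl A Al.
have nr : \forall s \near t, t < s -> A (f s) by exact: (fr _ Al).
have nl : \forall s \near t, s < t -> A (f s) by exact: (fl _ Al).
change (\forall s \near t, s != t -> A (f s)).
apply: filterS2 nr nl => s sr sl; rewrite neq_lt => /orP[]; [exact: sl|exact: sr].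
Qed.

Section tangent_extension.
Context {R : realType}.
Variables (p q : R) (psi : R -> R).
Hypothesis pq : p < q.
Hypothesis psiS : smooth_in `[p, q] psi.

Let I := `[p, q]%classic.
Let g := deriv_in I psi.
Let c t := clamp p q t.

Let c_itv t : p <= c t <= q. Proof. by apply: clamp_itv; exact: ltW. Qed.

(** Equal to [psi] on the interval and to the tangent line at the nearer endpoint
    outside it, since [c] is the nearest-point projection onto the interval. *)
Definition tangent_extension t := psi (c t) + g (c t) * (t - c t).

Let ext := tangent_extension.

Let extE t : p <= t <= q -> ext t = psi t.
Proof. by move=> tpq; rewrite /ext /tangent_extension /c clamp_id// subrr mulr0 addr0. Qed.

Let quot_cvg t : p <= t <= q -> diff_quot psi t @ within I t^' --> g t.
Proof. by move=> tpq; apply: (psiS (n := 0)); rewrite /I/= in_itv/=. Qed.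

Let right_within t : p <= t < q -> t^'+ `=>` within I t^'.
Proof.
move=> /andP[pt tq] A nA.
have nA1 : \forall s \near t, s != t -> I s -> A s by exact: nA.
have nA' : \forall s \near t^'+, s != t -> I s -> A s.
  exact: (@cvg_within _ (nbhs t) _ _ _ nA1).
near=> s; have st : t < s by near: s; exact: nbhs_right_gt.
have sq : s < q by near: s; exact: nbhs_right_lt.
have := near nA' s; apply; rewrite ?gt_eqF// /I/= in_itv/= (ltW sq) andbT.
exact: le_trans (ltW st).
Unshelve. all: by end_near. Qed.

Let left_within t : p < t <= q -> t^'- `=>` within I t^'.
Proof.
move=> /andP[pt tq] A nA.
have nA1 : \forall s \near t, s != t -> I s -> A s by exact: nA.
have nA' : \forall s \near t^'-, s != t -> I s -> A s.
  exact: (@cvg_within _ (nbhs t) _ _ _ nA1).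
near=> s; have st : s < t by near: s; exact: nbhs_left_lt.
have sq : p < s by near: s; exact: nbhs_left_gt.
have := near nA' s; apply; rewrite ?lt_eqF// /I/= in_itv/= (ltW sq)/=.
exact: le_trans (ltW st) _.
Unshelve. all: by end_near. Qed.

Let quot_affine t s : c s = c t -> s != t -> diff_quot ext t s = g (c t).
Proof.
move=> cst st; rewrite /diff_quot /ext /tangent_extension cst.
have st0 : s - t != 0 by rewrite subr_eq0.
by rewrite -[RHS](mulfK st0); congr (_ / _); ring.
Qed.

Let quot_ext t s : p <= t <= q -> p <= s <= q -> diff_quot ext t s = diff_quot psi t s.
Proof. by move=> tpq spq; rewrite /diff_quot !extE. Qed.

Let ext_right t : diff_quot ext t s @[s --> t^'+] --> g (c t).
Proof.
have pq' := ltW pq.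
have [qt|tq] := leP q t.
  apply: cvg_near_cst; near=> s.
  have st : t < s by near: s; exact: nbhs_right_gt.
  apply: quot_affine; last by rewrite gt_eqF.
  by rewrite /c !clamp_hi// (le_trans qt)// ltW.
have [pt|tp] := leP p t.
  have -> : c t = t by rewrite /c clamp_id// pt ltW.
  have tpq : p <= t <= q by rewrite pt ltW.
  have tpq' : p <= t < q by rewrite pt.
  apply: cvg_trans (cvg_trans (cvg_app _ (right_within tpq')) (quot_cvg tpq)).
  apply: near_eq_cvg; near=> s.
  have st : t < s by near: s; exact: nbhs_right_gt.
  have sq : s < q by near: s; exact: nbhs_right_lt.
  by rewrite quot_ext// (ltW sq) (le_trans pt (ltW st)).
apply: cvg_near_cst; near=> s.
have st : t < s by near: s; exact: nbhs_right_gt.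
have sp : s < p by near: s; exact: nbhs_right_lt.
apply: quot_affine; last by rewrite gt_eqF.
by rewrite /c !clamp_lo// ltW.
Unshelve. all: by end_near. Qed.

Let ext_left t : diff_quot ext t s @[s --> t^'-] --> g (c t).
Proof.
have pq' := ltW pq.
have [tp|pt] := leP t p.
  apply: cvg_near_cst; near=> s.
  have st : s < t by near: s; exact: nbhs_left_lt.
  apply: quot_affine; last by rewrite lt_eqF.
  by rewrite /c !clamp_lo// (le_trans _ tp)// ltW.
have [tq|qt] := leP t q.
  have -> : c t = t by rewrite /c clamp_id// tq ltW.
  have tpq : p <= t <= q by rewrite tq ltW.
  have tpq' : p < t <= q by rewrite tq pt.
  apply: cvg_trans (cvg_trans (cvg_app _ (left_within tpq')) (quot_cvg tpq)).
  apply: near_eq_cvg; near=> s.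
  have st : s < t by near: s; exact: nbhs_left_lt.
  have sq : p < s by near: s; exact: nbhs_left_gt.
  by rewrite quot_ext// (ltW sq) (le_trans (ltW st) tq).
apply: cvg_near_cst; near=> s.
have st : s < t by near: s; exact: nbhs_left_lt.
have sp : q < s by near: s; exact: nbhs_left_gt.
apply: quot_affine; last by rewrite lt_eqF.
by rewrite /c !clamp_hi// ltW.
Unshelve. all: by end_near. Qed.

Lemma is_derive_diff_quot (f : R -> R) (t l : R) :
  diff_quot f t s @[s --> t^'] --> l -> is_derive t 1 f l.
Proof.
move=> fl.
have sl : (fun h => h^-1 *: (f (h *: 1 + t) - f t)) h @[h --> 0^'] --> l.
  have sh : (h + t) @[h --> 0^'] --> t^'.
    move=> A nA; have nA1 : \forall s \near t, s != t -> A s by exact: nA.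
    have sh0 : h + t @[h --> (0 : R)] --> t.
      by rewrite -[X in _ --> X]add0r; apply: cvgD; [exact: cvg_id|exact: cvg_cst].
    have := sh0 _ nA1 => nA2.
    have nA3 : \forall h \near 0^', h + t != t -> A (h + t).
      exact: (@cvg_within _ (nbhs (0 : R)) _ _ _ nA2).
    change (\forall h \near 0^', A (h + t)).
    near=> h; have hA : h + t != t -> A (h + t) by near: h; exact: nA3.
    apply: hA.
    by rewrite addrC -subr_eq0 addrAC subrr add0r; near: h; exact: nbhs_dnbhs_neq.
  apply: cvg_trans (cvg_comp _ _ sh fl).
  apply: near_eq_cvg; near=> h.
  by rewrite /diff_quot/= addrK /GRing.scale/= mulr1 mulrC.
apply: DeriveDef; first by apply/cvg_ex; exists l.
exact: cvg_lim sl.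
Unshelve. all: by end_near. Qed.

(** Inside the interval the one-sided quotients are those of [psi]; outside they
    are constant; at an endpoint one side is of each kind, with the same limit. *)
Lemma is_derive_tangent_extension (t : R) : is_derive t 1 ext (g (c t)).
Proof.
by apply: is_derive_diff_quot; apply: cvg_dnbhs_left_right.
Qed.

Let g_cvg t : p <= t <= q -> g s @[s --> within I t^'] --> g t.
Proof.
move=> tpq.
have gq : cvg (diff_quot g t s @[s --> within I t^']).
  by have := @psiS 1%N t; rewrite /I/= in_itv/=; apply.
have st : s - t @[s --> within I t^'] --> t - t.
  apply: cvgB; last exact: cvg_cst.
  exact: (cvg_trans (cvg_within _) (cvg_within _)).
have ne : \forall s \near within I t^', s != t.
  exact: (@cvg_within _ (t^') _ I _ (nbhs_dnbhs_neq t)).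
have : g t + diff_quot g t s * (s - t) @[s --> within I t^'] -->
    g t + lim (diff_quot g t s @[s --> within I t^']) * (t - t).
  by apply: cvgD; [exact: cvg_cst|exact: cvgM].
rewrite subrr mulr0 addr0; apply: cvg_trans.
apply: near_eq_cvg; near=> s.
have s_neq_t : s - t != 0.
  by rewrite subr_eq0; near: s; exact: ne.
by rewrite /diff_quot divfK// addrC subrK.
Unshelve. all: by end_near. Qed.

Let cg : {within `[p, q], continuous g}.
Proof.
apply/continuous_within_itvP => //; split.
- move=> t; rewrite in_itv/= => /andP[pt tq].
  apply/continuous_withinNx; apply: cvg_dnbhs_left_right.
    have tpq' : p <= t < q by rewrite (ltW pt).
    apply: cvg_trans (cvg_app _ (right_within tpq')) _; apply: g_cvg.
    by rewrite !ltW.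
  have tpq' : p < t <= q by rewrite pt ltW.
  apply: cvg_trans (cvg_app _ (left_within tpq')) _; apply: g_cvg.
  by rewrite !ltW.
- have tpq' : p <= p < q by rewrite lexx.
  apply: cvg_trans (cvg_app _ (right_within tpq')) _; apply: g_cvg.
  by rewrite lexx ltW.
- have tpq' : p < q <= q by rewrite lexx andbT.
  apply: cvg_trans (cvg_app _ (left_within tpq')) _; apply: g_cvg.
  by rewrite lexx ltW.
Qed.

Let kappa t := ext t - t * g t.

Let ckappa : {within `[p, q], continuous kappa}.
Proof.
have cext : continuous ext.
  move=> t; apply: differentiable_continuous; apply/derivable1_diffP.
  by have := is_derive_tangent_extension t => ?; exact: ex_derive.
move=> t; apply: cvgB; first exact: (continuous_subspaceT cext).
apply: cvgM; last exact: cg.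
exact: (continuous_subspaceT (fun x => @cvg_id _ (nbhs x))).
Qed.

(** The key property of the continuation: [kappa t] is the intercept of the
    tangent at [t], and beyond an endpoint the tangent stays the same line. *)
Let kappaE t : ext t - t * g (c t) = kappa (c t).
Proof.
rewrite /kappa (extE (c_itv t)).
by rewrite /ext /tangent_extension; ring.
Qed.

Lemma tangent_extension_bounded : exists M, forall t,
  `|ext t - t * g (c t)| <= M.
Proof.
have [u _ umax] := EVT_max (ltW pq) ckappa.
have [v _ vmin] := EVT_min (ltW pq) ckappa.
exists (`|kappa u| + `|kappa v|) => t; rewrite kappaE.
have cI : c t \in `[p, q]%R by rewrite in_itv/= c_itv.
have h1 := le_trans (umax _ cI) (ler_norm (kappa u)).
have h2 : - `|kappa v| <= kappa v by rewrite lerNl -normrN ler_norm.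
have {}h2 := le_trans h2 (vmin _ cI).
rewrite ler_norml; apply/andP; split.
  by apply: le_trans h2; rewrite lerN2 lerDr normr_ge0.
by apply: le_trans h1 _; rewrite lerDl normr_ge0.
Qed.

Hypothesis nondegenerate : forall t, I t -> psi t - t * g t != 0.

Let kappa_neq0 t : p <= t <= q -> kappa t != 0.
Proof.
by move=> tpq; rewrite /kappa extE//; apply: nondegenerate; rewrite /I/= in_itv.
Qed.

Let no_root t : p <= t <= q -> ~ (Num.min (kappa p) (kappa t) <= 0 <= Num.max (kappa p) (kappa t)).
Proof.
move=> /andP[pt tq] h.
have cpt : {within `[p, t], continuous kappa}.
  apply: continuous_subspaceW ckappa => x /=; rewrite !in_itv/= => /andP[-> xt].
  exact: le_trans tq.
have [x] := IVT pt cpt h; rewrite in_itv/= => /andP[px xt] x0.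
by move/eqP: x0; apply/negP; apply: kappa_neq0; rewrite px (le_trans xt).
Qed.

(** By the intermediate value theorem, since [kappa] is continuous on the interval
    and has no zero there. *)
Lemma tangent_extension_sign :
  (forall t, 0 <= ext t - t * g (c t)) \/ (forall t, ext t - t * g (c t) <= 0).
Proof.
have [kp|kp] := leP 0 (kappa p); [left|right] => t; rewrite kappaE leNgt; apply/negP => kt;
  apply: (no_root (c_itv t)).
  rewrite ge_min le_max; apply/andP; split; apply/orP; first by right; exact: ltW.
  by left.
rewrite ge_min le_max; apply/andP; split; apply/orP; first by left; exact: ltW.
by right; exact: ltW.
Qed.

End tangent_extension.

(** * Regularity of the amplitude and measurability on the plane *)
Section amplitude.
Context {R : realType}.
Implicit Types (al : R * R -> R) (K : set (R * R)).

Lemma compact_support_bounded (F : R * R -> R) K : compact K -> continuous F ->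
  (forall x, ~ K x -> F x = 0) -> exists2 A, 0 <= A & forall x, `|F x| <= A.
Proof.
move=> cK cF F0.
have [M [_ /(_ (`|M| + 1)) MF]] := compact_bounded (continuous_compact (continuous_subspaceT cF) cK).
exists (`|M| + 1) => [|x]; first by rewrite addr_ge0.
have [Kx|nKx] := pselect (K x); last by rewrite F0// normr0 addr_ge0.
apply: MF; first by rewrite (le_lt_trans (ler_norm M))// ltrDl.
by exists x.
Qed.

(** Outside the closed set [K] the function vanishes near each point, so the
    derivative is supported in [K] as well. *)
Lemma derivative_bounded al K v : compact K -> (forall x, ~ K x -> al x = 0) ->
  continuous (fun x => 'D_v al x) -> exists2 A, 0 <= A & forall x, `|'D_v al x| <= A.
Proof.
move=> cK al0 cD; apply: (compact_support_bounded cK cD) => x nKx.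
have clK : closed K by apply: compact_closed.
have nx : \forall y \near x, al y = (cst 0 : R * R -> R) y.
  have : nbhs x (~` K) by apply: open_nbhs_nbhs; split => //; exact: closed_openC.
  by apply: filterS => y /al0.
by rewrite (near_eq_derive v nx) derive_cst.
Qed.

Lemma compact_support_lipschitz al K : compact K -> (forall x, ~ K x -> al x = 0) ->
  smooth2 al -> exists2 L, 0 <= L &
  forall x y, `|al x - al y| <= L * (`|x.1 - y.1| + `|x.2 - y.2|).
Proof.
move=> cK al0 sal.
have [L1 L10 L1P] := derivative_bounded cK al0 (sal [:: false]).1.
have [L2 L20 L2P] := derivative_bounded cK al0 (sal [:: true]).1.
have mean_value (f df : R -> R) A s t : (forall u : R, is_derive u 1 f (df u)) ->
    (forall u, `|df u| <= A) -> `|f s - f t| <= A * `|s - t|.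
  move=> fdf dfA; wlog st : s t / t <= s.
    by move=> W; have [/W//|/ltW/W] := leP t s; rewrite distrC [`|t - s|]distrC.
  have cf : {within `[t, s], continuous f}.
    apply: continuous_subspaceT => u; apply: differentiable_continuous.
    by apply/derivable1_diffP; exact: ex_derive.
  have [u _ ->] := MVT_segment st (fun u _ => fdf u) cf.
  by rewrite normrM ler_wpM2r.
have d1 (x2 u : R) : is_derive u 1 (fun t => al (t, x2)) ('D_(1, 0) al (u, x2)).
  have [_ /(_ false (u, x2)) dal] := sal [::].
  have E : (fun h : R => h^-1 *: ((al \o shift (u, x2)) (h *: (1, 0)) - al (u, x2))) =
      (fun h => h^-1 *: (((fun t => al (t, x2)) \o shift u) (h *: 1) - al (u, x2))).
    apply/funext => h; congr (_ *: (_ - _)).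
    change (al (h *: 1 + u, h *: 0 + x2) = al (h *: 1 + u, x2)).
    by rewrite scaler0 add0r.
  by apply: DeriveDef; rewrite /derivable /derive -E.
have d2 (x1 u : R) : is_derive u 1 (fun t => al (x1, t)) ('D_(0, 1) al (x1, u)).
  have [_ /(_ true (x1, u)) dal] := sal [::].
  have E : (fun h : R => h^-1 *: ((al \o shift (x1, u)) (h *: (0, 1)) - al (x1, u))) =
      (fun h => h^-1 *: (((fun t => al (x1, t)) \o shift u) (h *: 1) - al (x1, u))).
    apply/funext => h; congr (_ *: (_ - _)).
    change (al (h *: 0 + x1, h *: 1 + u) = al (x1, h *: 1 + u)).
    by rewrite scaler0 add0r.
  by apply: DeriveDef; rewrite /derivable /derive -E.
exists (L1 + L2); first exact: addr_ge0.
move=> [x1 x2] [y1 y2] /=.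
have -> : al (x1, x2) - al (y1, y2) =
   (al (x1, x2) - al (y1, x2)) + (al (y1, x2) - al (y1, y2)) by ring.
apply: le_trans (ler_normD _ _) _; rewrite mulrDr lerD//.
  apply: le_trans (mean_value _ _ _ _ _ (d1 x2) (fun u => L1P (u, x2))) _.
  by rewrite ler_wpM2r// lerDl.
apply: le_trans (mean_value _ _ _ _ _ (d2 y1) (fun u => L2P (y1, u))) _.
by rewrite ler_wpM2r// lerDr.
Qed.

End amplitude.

Section measurability.
Context {R : realType}.

(** The sigma-algebra on the plane is the product one, so an open set is shown
    measurable as a countable union of rational squares. *)
Lemma open_measurable_plane (O : set (R * R)) : open O ->
  measurable (O : set (measurableTypeR R * measurableTypeR R)).
Proof.
move=> oO.
pose box (a b e : rat) : set (R * R) :=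
  ball (ratr a : R) (ratr e) `*` ball (ratr b : R) (ratr e).
pose F a b e := if pselect (box a b e `<=` O) then box a b e else set0.
have -> : O = \bigcup_a \bigcup_b \bigcup_e F a b e.
  apply/seteqP; split=> [[x1 x2] Ox|x [a _ [b _ [e _]]]]; last first.
    by rewrite /F; case: pselect => // h; exact: h.
  have /nbhs_ballP[d /= d0 dO] : nbhs (x1, x2) O by exact: open_nbhs_nbhs.
  have /rat_in_itvoo[e] : 0 < d / 2 by rewrite divr_gt0.
  rewrite in_itv/= => /andP[e0 ed].
  have /rat_in_itvoo[a] : x1 - ratr e < x1 + ratr e by rewrite ltrD2l gt0_cp.
  rewrite in_itv/= => /andP[a1 a2].
  have /rat_in_itvoo[b] : x2 - ratr e < x2 + ratr e by rewrite ltrD2l gt0_cp.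
  rewrite in_itv/= => /andP[b1 b2].
  exists a => //; exists b => //; exists e => //.
  have xa : ball (ratr a : R) (ratr e) x1.
    by rewrite /ball/= ltr_norml; apply/andP; split; lra.
  have xb : ball (ratr b : R) (ratr e) x2.
    by rewrite /ball/= ltr_norml; apply/andP; split; lra.
  rewrite /F; case: pselect => [h|[]] /=; first by split.
  move=> [y1 y2] [/= h1 h2]; apply: dO.
  have de : d = d / 2 + d / 2 by rewrite -splitr.
  have led : ratr e <= d / 2 by exact: ltW.
  split => /=.
    rewrite de; apply: (@ball_triangle _ _ (ratr a : R)).
      exact: (le_ball led (ball_sym xa)).
    exact: (le_ball led h1).
  rewrite de; apply: (@ball_triangle _ _ (ratr b : R)).
    exact: (le_ball led (ball_sym xb)).
  exact: (le_ball led h2).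
apply: bigcupT_measurable_rat => a; apply: bigcupT_measurable_rat => b.
apply: bigcupT_measurable_rat => e.
rewrite /F; case: pselect => h //=; apply: measurableX; exact: measurable_ball.
Qed.

Lemma continuous_measurable_plane (f : R * R -> R) : continuous f ->
  measurable_fun setT (f : measurableTypeR R * measurableTypeR R -> R).
Proof.
move=> cf; apply: (measurability _ (RGenOInfty.measurableE R)).
move=> /= _ [_ [a ->]] <-; apply: measurableI => //.
apply: open_measurable_plane; apply: (open_comp (f := f)).
  by move=> x _; exact: cf.
by rewrite set_itvoy; exact: open_gt.
Qed.

End measurability.

(** * The multiplier along rays *)
Section ray.
Context {R : realType}.

Lemma dist_max0 (a b : R) : `|Num.max a 0 - Num.max b 0| <= `|b - a|.
Proof.
have h1 := ler_norm (b - a); have : a - b <= `|b - a| by rewrite distrC ler_norm.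
have h0 := normr_ge0 (b - a); rewrite ler_norml; move: (`|b - a|) h0 h1 => d h0 h1 h2.
by rewrite !maxEle; case: ifPn; case: ifPn; rewrite -?ltNge => *; apply/andP; split; lra.
Qed.

(** Polar coordinates use this norm instead of the Euclidean one: its unit
    vectors have coordinates of absolute value at most 1, and its balls are
    squares. *)
Definition sup2 (x : R * R) : R := Num.max `|x.1| `|x.2|.

(** [al] stands for the real or the imaginary part of the amplitude. *)
Variables (al : R * R -> R) (psi g : R -> R) (lam L r0 R0 M Psi : R).
Hypothesis lam0 : 0 < lam.
Hypothesis r00 : 0 < r0.
Hypothesis r0R0 : r0 < R0.
Hypothesis L0 : 0 <= L.
Hypothesis alL : forall x y, `|al x - al y| <= L * (`|x.1 - y.1| + `|x.2 - y.2|).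
Hypothesis al0 : forall x, al x != 0 -> r0 < sup2 x < R0.
Hypothesis dpsi : forall t : R, is_derive t 1 psi (g t).
Hypothesis kM : forall t, `|psi t - t * g t| <= M.
Hypothesis ksg : (forall t, 0 <= psi t - t * g t) \/ (forall t, psi t - t * g t <= 0).
Hypothesis Psi_ge : forall t, `|t| <= R0 -> `|psi t| <= Psi.

Definition edge (x : R * R) : R := al x * (Num.max (x.2 - psi x.1) 0 `^ lam).

Let R00 : 0 < R0. Proof. exact: lt_trans r0R0. Qed.

Let M0 : 0 <= M. Proof. exact: le_trans (kM 0). Qed.

Let B := 1 + Psi / r0.

Let B0 : 0 <= B.
Proof.
rewrite addr_ge0// divr_ge0 ?(ltW r00)//.
by apply: le_trans (normr_ge0 (psi 0)) _; apply: Psi_ge; rewrite normr0 ltW.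
Qed.

Let Mal := 3 * L * R0.

Let Mal0 : 0 <= Mal. Proof. by rewrite !mulr_ge0// ltW. Qed.

(** [al] vanishes at (R0, 0), which lies at bounded distance from its support. *)
Let al_le x : `|al x| <= Mal.
Proof.
have [->|/al0/andP[_ xR]] := eqVneq (al x) 0; first by rewrite normr0.
have aR : al (R0, 0) = 0.
  apply/eqP; apply: contraT => /al0/andP[_].
  by rewrite /sup2/= normr0 (max_idPl (normr_ge0 _)) (gtr0_norm R00) ltxx.
rewrite -[al x]subr0 -aR; apply: le_trans (alL _ _) _.
rewrite /Mal [3 * L]mulrC -mulrA; apply: ler_wpM2l => //=.
move: xR; rewrite gt_max => /andP[/ltW x1 /ltW x2]; rewrite subr0.
have := ler_normB x.1 R0; rewrite (gtr0_norm R00); lra.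
Qed.

Section direction.
Variable w : R * R.
Hypothesis w1 : sup2 w = 1.

Let w11 : `|w.1| <= 1. Proof. by rewrite -w1 le_max lexx. Qed.
Let w21 : `|w.2| <= 1. Proof. by rewrite -w1 le_max lexx orbT. Qed.

(** The factor of the multiplier that remains after homogeneity: by [edgeE] below,
    [edge] at t w is [al] times t^lam times the lam-th power of the positive
    part of [slope t]. *)
Definition slope (t : R) : R := w.2 - psi (t * w.1) / t.

Let dslope (t : R) : 0 < t ->
  is_derive t 1 slope ((psi (t * w.1) - t * w.1 * g (t * w.1)) / t ^+ 2).
Proof.
move=> t0.
have d1 : is_derive t 1 (fun t => psi (t * w.1)) (g (t * w.1) * w.1).
  apply: (@is_derive1_comp _ psi (fun t => t * w.1)).
  by apply: is_derive_eq; rewrite /GRing.scale/=; ring.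
have t_neq0 : t != 0 by rewrite gt_eqF.
have d2 : is_derive t 1 (fun t : R => t^-1) (- t ^- 2).
  have := @is_deriveV R id t 1 1 t_neq0 (is_derive_id t 1).
  by rewrite /GRing.scale/= mulr1.
rewrite /slope; apply: is_derive_eq.
by rewrite /GRing.scale/=; field.
Qed.

Let cslope s t : 0 < s -> {within `[s, t], continuous slope}.
Proof.
move=> s0; apply: continuous_in_subspaceT => x; rewrite inE/= in_itv/= => /andP[sx _].
apply: differentiable_continuous; apply/derivable1_diffP.
by have /(_ (lt_le_trans s0 sx)) dx := @dslope x; exact: ex_derive.
Qed.

Let slope_mvt s t : 0 < s -> s <= t -> exists2 c, s <= c &
  slope t - slope s = (psi (c * w.1) - c * w.1 * g (c * w.1)) / c ^+ 2 * (t - s).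
Proof.
move=> s0; rewrite le_eqVlt => /predU1P[<-|st].
  by exists s => //; rewrite !subrr mulr0.
have ds (x : R) : x \in `]s, t[%R -> is_derive x 1 slope
    ((psi (x * w.1) - x * w.1 * g (x * w.1)) / x ^+ 2).
  by rewrite in_itv/= => /andP[/(lt_trans s0) x0 _]; exact: dslope.
have [c cst ->] := MVT st ds (@cslope s t s0).
by exists c => //; move: cst; rewrite in_itv/= => /andP[/ltW].
Qed.

(** The derivative of [slope] at t is (psi y - y psi' y) / t^2 with y = t w_1, of
    constant sign. *)
Let slope_monotone : (forall s t, 0 < s -> s <= t -> slope s <= slope t) \/
  (forall s t, 0 < s -> s <= t -> slope t <= slope s).
Proof.
case: ksg => k0; [left|right] => s t s0 st; have [c sc e] := slope_mvt s0 st.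
  by rewrite -subr_ge0 e mulr_ge0 ?subr_ge0// mulr_ge0// invr_ge0 sqr_ge0.
by rewrite -subr_le0 e mulr_le0_ge0 ?subr_ge0// mulr_le0_ge0// invr_ge0 sqr_ge0.
Qed.

Let slope_lipschitz s t : r0 <= s -> s <= t ->
  `|slope t - slope s| <= M / r0 ^+ 2 * (t - s).
Proof.
move=> rs st; have [c sc ->] := slope_mvt (lt_le_trans r00 rs) st.
have c0 : 0 < c by rewrite (lt_le_trans r00)// (le_trans rs).
rewrite normrM [`|t - s|]ger0_norm ?subr_ge0// ler_wpM2r ?subr_ge0//.
rewrite normrM [`|_^-1|]ger0_norm ?invr_ge0 ?sqr_ge0//.
rewrite ler_pM ?invr_ge0 ?sqr_ge0// lef_pV2 ?posrE ?exprn_gt0//.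
by rewrite ler_pXn2r ?nnegrE ?(ltW r00) ?(ltW c0)// (le_trans rs).
Qed.

Let slope_le t : r0 <= t <= R0 -> `|slope t| <= B.
Proof.
move=> /andP[rt tR]; have t0 : 0 < t by exact: lt_le_trans rt.
apply: le_trans (ler_normB _ _) _; rewrite lerD// normrM normfV (gtr0_norm t0).
have psit : `|psi (t * w.1)| <= Psi.
  apply: Psi_ge; rewrite normrM (gtr0_norm t0) -[leRHS]mulr1 ler_pM//.
  exact: ltW.
by rewrite ler_pM ?invr_ge0 ?(ltW t0)// lef_pV2 ?posrE.
Qed.

Let spow t := Num.max (slope t) 0 `^ lam.

Let edgeE t : 0 < t -> edge (t *: w) = al (t *: w) * (t `^ lam * spow t).
Proof.
move=> t0; rewrite /edge /spow -powRM ?(ltW t0)//; last by rewrite le_max lexx orbT.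
by rewrite maxr_pMr ?(ltW t0)// mulr0 /slope mulrBr mulrCA mulfV ?gt_eqF// mulr1.
Qed.

Let maxB t : r0 <= t <= R0 -> 0 <= Num.max (slope t) 0 <= B.
Proof.
move=> /slope_le; rewrite ler_norml => /andP[_ sB].
by rewrite le_max lexx orbT ge_max sB B0.
Qed.

Let spow_le t : r0 <= t <= R0 -> 0 <= spow t <= B `^ lam.
Proof.
move=> /maxB/andP[m0 mB]; rewrite powR_ge0/=.
by apply: ge0_ler_powR => //; exact: ltW.
Qed.

Let tpow_le t : r0 <= t <= R0 -> 0 <= t `^ lam <= R0 `^ lam.
Proof.
move=> /andP[rt tR]; rewrite powR_ge0/=.
have t0 := ltW (lt_le_trans r00 rt).
by apply: ge0_ler_powR; rewrite ?nnegrE ?(ltW lam0) ?(ltW R00).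
Qed.

Let alw_lipschitz s t : `|al (s *: w) - al (t *: w)| <= 2 * L * `|s - t|.
Proof.
apply: le_trans (alL _ _) _; rewrite /= -!mulrBl !normrM.
rewrite [2 * L]mulrC -mulrA ler_wpM2l//.
have := ler_wpM2l (normr_ge0 (s - t)) w11; have := ler_wpM2l (normr_ge0 (s - t)) w21.
lra.
Qed.

(** Along the ray the multiplier is a product of the Lipschitz factor [al] and of
    two bounded monotone factors; t^lam increases and the power of the positive part
    of [slope] inherits the monotonicity of [slope]. *)
Lemma edge_variation n (x : nat -> R) : monotone_seq x ->
  (forall j, r0 <= x j <= R0) ->
  variation n (fun j => edge (x j *: w)) <=
  Mal * (R0 `^ lam * B `^ lam + B `^ lam * R0 `^ lam) +
  R0 `^ lam * B `^ lam * (2 * L * R0).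
Proof.
move=> mx xr; have x0 j : 0 < x j by have /andP[/(lt_le_trans r00)] := xr j.
rewrite (_ : (fun j => _) =
    (fun j => al (x j *: w) * (x j `^ lam * spow (x j)))); last first.
  by apply/funext => j; rewrite edgeE.
have R0lam : 0 <= R0 `^ lam by exact: powR_ge0.
have Blam : 0 <= B `^ lam by exact: powR_ge0.
have nx j : `|x j `^ lam| <= R0 `^ lam.
  by rewrite ger0_norm ?powR_ge0//; have /andP[] := tpow_le (xr j).
have ns j : `|spow (x j)| <= B `^ lam.
  by rewrite ger0_norm ?powR_ge0//; have /andP[] := spow_le (xr j).
have le_pow y z : 0 <= y -> y <= z -> y `^ lam <= z `^ lam.
  move=> y0 yz; apply: ge0_ler_powR; rewrite ?nnegrE ?(ltW lam0)//.
  exact: le_trans yz.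
have mxl : monotone_seq (fun j => x j `^ lam).
  by case: mx => mx; [left|right] => j; apply: le_pow => //; exact: ltW.
have msl : monotone_seq (fun j => spow (x j)).
  have max0 (y : R) : 0 <= Num.max y 0 by rewrite le_max lexx orbT.
  have le_max0 (y z : R) : y <= z -> Num.max y 0 <= Num.max z 0.
    by move=> yz; rewrite ge_max !le_max yz lexx orbT.
  case: mx => mx; case: slope_monotone => ms; [left|right|right|left] => j;
    by apply: le_pow => //; apply: le_max0; apply: ms.
have vx : variation n x <= R0.
  apply: (le_trans (variation_monotone n mx xr)).
  by rewrite lerBlDr lerDl ltW.
apply: (le_trans (variation_mul n (A := Mal) (B := R0 `^ lam * B `^ lam) _ _)) => //.
  by move=> j; rewrite normrM ler_pM.
rewrite lerD//; last first.
  apply: ler_wpM2l; first by rewrite mulr_ge0.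
  apply: (le_trans (variation_lipschitz (L := 2 * L) n (x := x) _)).
    by move=> j; exact: alw_lipschitz.
  by rewrite ler_wpM2l// mulr_ge0.
apply: ler_wpM2l => //; apply: (le_trans (variation_mul n nx ns)).
rewrite lerD// ler_wpM2l//.
  apply: (le_trans (variation_monotone n msl (lo := 0) (hi := B `^ lam) _)).
    by move=> j; exact: spow_le.
  by rewrite subr0.
apply: (le_trans (variation_monotone n mxl (lo := 0) (hi := R0 `^ lam) _)).
  by move=> j; exact: tpow_le.
by rewrite subr0.
Qed.

Lemma edge_le t : r0 <= t <= R0 -> `|edge (t *: w)| <= Mal * (R0 `^ lam * B `^ lam).
Proof.
move=> tr; have /andP[rt _] := tr; rewrite edgeE ?(lt_le_trans r00)// normrM ler_pM//.
have /andP[t0 tR] := tpow_le tr; have /andP[s0 sB] := spow_le tr.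
by rewrite normrM !ger0_norm// ler_pM.
Qed.

(** Here t^lam and the power of [slope] are taken together as the lam-th power of
    the Lipschitz function [P]; the Lipschitz factor [al] is Hoelder because
    distances in [r0, R0] are at most R0. *)
Lemma edge_holder mu H s t : 0 < mu <= 1 -> 0 <= H ->
  (forall x y, 0 <= x <= R0 * B -> 0 <= y <= R0 * B ->
     `|x `^ lam - y `^ lam| <= H * `|x - y| `^ mu) ->
  r0 <= s <= R0 -> r0 <= t <= R0 ->
  `|edge (s *: w) - edge (t *: w)| <=
  (2 * L * R0 `^ (1 - mu) * (R0 `^ lam * B `^ lam) +
   Mal * (H * (B + R0 * (M / r0 ^+ 2)) `^ mu)) * `|s - t| `^ mu.
Proof.
move=> /andP[mu0 mu1] H0 Hol.
wlog st : s t / s <= t.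
  move=> W sr tr; have [st|/ltW ts] := leP s t; first exact: W.
  by rewrite distrC [`|s - t|]distrC; exact: W.
move=> sr tr; have /andP[rs sR] := sr; have /andP[rt tR] := tr.
have s0 : 0 < s by exact: lt_le_trans rs.
have t0 : 0 < t by exact: lt_le_trans rt.
pose P x := x * Num.max (slope x) 0.
have PE x : r0 <= x <= R0 -> x `^ lam * spow x = P x `^ lam.
  move=> xr; have /andP[m0 _] := maxB xr.
  have /andP[rx _] := xr; have x0 := ltW (lt_le_trans r00 rx).
  by rewrite /spow powRM.
have P_itv x : r0 <= x <= R0 -> 0 <= P x <= R0 * B.
  move=> xr; have /andP[m0 mB] := maxB xr; have /andP[rx xR] := xr.
  have x0 : 0 <= x by rewrite ltW// (lt_le_trans r00).
  by rewrite mulr_ge0//= ler_pM.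
have absst : `|s - t| = t - s by rewrite distrC ger0_norm// subr_ge0.
have PL : `|P s - P t| <= (B + R0 * (M / r0 ^+ 2)) * `|s - t|.
  have -> : P s - P t = (s - t) * Num.max (slope s) 0 +
      t * (Num.max (slope s) 0 - Num.max (slope t) 0) by rewrite /P; ring.
  apply: le_trans (ler_normD _ _) _; rewrite !normrM mulrDl lerD//.
    rewrite mulrC ler_wpM2r//; have /andP[m0 mB] := maxB sr.
    by rewrite ger0_norm.
  rewrite -mulrA (gtr0_norm t0) ler_pM ?(ltW t0)//.
  rewrite absst; apply: le_trans (slope_lipschitz rs st).
  exact: dist_max0.
have C0 : 0 <= B + R0 * (M / r0 ^+ 2).
  by rewrite addr_ge0// mulr_ge0 ?(ltW R00)// divr_ge0// sqr_ge0.
rewrite !edgeE// !PE//.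
have -> : al (s *: w) * P s `^ lam - al (t *: w) * P t `^ lam =
  (al (s *: w) - al (t *: w)) * P s `^ lam +
  al (t *: w) * (P s `^ lam - P t `^ lam) by ring.
apply: le_trans (ler_normD _ _) _; rewrite !normrM mulrDl lerD//.
  rewrite -PE//; have /andP[a0 aR] := tpow_le sr; have /andP[b0 bB] := spow_le sr.
  rewrite [`|s `^ lam * _|]ger0_norm ?mulr_ge0// mulrAC ler_pM ?mulr_ge0//; last exact: ler_pM.
  apply: le_trans (alw_lipschitz _ _) _.
  rewrite -[leRHS]mulrA ler_wpM2l ?mulr_ge0//.
  have [->|st0] := eqVneq `|s - t| 0; first by rewrite mulr_ge0// powR_ge0.
  have e : `|s - t| `^ (1 - mu) * `|s - t| `^ mu = `|s - t|.
    by rewrite -powRD ?st0 ?implybT// subrK powRr1.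
  rewrite -{1}e.
  rewrite ler_wpM2r ?powR_ge0//; apply: ge0_ler_powR; rewrite ?nnegrE ?subr_ge0//.
  - exact: ltW.
  - by rewrite absst; lra.
rewrite -mulrA ler_pM//; apply: le_trans (Hol _ _ (P_itv _ sr) (P_itv _ tr)) _.
rewrite -mulrA ler_wpM2l// -powRM//.
by apply: ge0_ler_powR; rewrite ?nnegrE ?mulr_ge0// ltW.
Qed.

End direction.

Lemma sup2_ge0 x : 0 <= sup2 x.
Proof. by rewrite le_max normr_ge0. Qed.

Lemma sup2_scale (c : R) x : 0 <= c -> sup2 (c *: x) = c * sup2 x.
Proof. by move=> c0; rewrite /sup2/= !normrM (ger0_norm c0) maxr_pMr. Qed.

Let edge0 x : ~~ (r0 < sup2 x < R0) -> edge x = 0.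
Proof.
by move=> h; rewrite /edge; have [->|/al0] := eqVneq (al x) 0; [rewrite mul0r|rewrite (negbTE h)].
Qed.

(** The multiplier vanishes outside the annulus and on its boundary, so radii may
    be moved to the nearest point of [r0, R0] without changing its values; there
    the estimates along rays hold. *)
Let edge_clamp w t : sup2 w = 1 -> 0 < t -> edge (t *: w) = edge (clamp r0 R0 t *: w).
Proof.
move=> w1 t0; have rR := ltW r0R0.
have out u : 0 <= u -> ~~ (r0 < u < R0) -> edge (u *: w) = 0.
  by move=> u0 h; apply: edge0; rewrite sup2_scale// w1 mulr1.
have eR : edge (R0 *: w) = 0 by apply: out; rewrite ?(ltW R00)// ltxx andbF.
have er : edge (r0 *: w) = 0 by apply: out; rewrite ?(ltW r00)// ltxx.
have [tr|rt] := leP t r0.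
  have e : edge (t *: w) = 0 by apply: out; rewrite ?(ltW t0)// negb_and -leNgt tr.
  by rewrite (clamp_lo tr rR) e er.
have [Rt|tR] := leP R0 t.
  have e : edge (t *: w) = 0 by apply: out; rewrite ?(ltW t0)// negb_and -!leNgt Rt orbT.
  by rewrite (clamp_hi Rt rR) e eR.
by rewrite clamp_id// (ltW rt) ltW.
Qed.

Let expR_sub1 (d : R) : 0 <= d <= 1 -> expR d - 1 <= expR 1 * d.
Proof.
move=> /andP[d0 d1]; have := expR_ge1Dx (- d).
rewrite expRN -(ler_pM2r (expR_gt0 d)) mulVf ?gt_eqF ?expR_gt0// => h.
have : expR d * d <= expR 1 * d by rewrite ler_wpM2r// ler_expR.
lra.
Qed.

Let clamp_step s t d : 0 < s -> s <= t -> t <= s * expR d -> 0 <= d <= 1 ->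
  `|clamp r0 R0 t - clamp r0 R0 s| <= R0 * expR 1 * d.
Proof.
move=> s0 st ts d01; have rR := ltW r0R0; have /andP[d0 _] := d01.
rewrite ger0_norm ?subr_ge0 ?le_clamp//.
have [Rs|sR] := leP R0 s.
  rewrite !clamp_hi// ?(le_trans Rs)// subrr.
  by rewrite !mulr_ge0 ?expR_ge0// ltW.
apply: (le_trans (clamp_dist _ _ st)).
apply: (@le_trans _ _ (s * (expR d - 1))); first by rewrite mulrBr mulr1 lerD2r.
rewrite -mulrA ler_pM ?(ltW s0) ?(ltW sR) ?expR_sub1// subr_ge0.
by rewrite -expR0 ler_expR.
Qed.

Let dyadicS k j : dyadic k j.+1 = dyadic k j + 2^-1 ^+ k :> R.
Proof. by rewrite /dyadic -natr1 mulrDl mul1r exprVn. Qed.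

(** For k > 0, [edge_holder] bounds each increment by a multiple of 2^(-k mu) and
    [edge_variation] bounds their total, uniformly in the direction and in k; the
    sum of squares is at most the product, which is C rho^(2k) for
    rho = 2^(-mu/2). *)
Lemma edge_increments : exists C rho : R, [/\ 0 < C, 0 < rho < 1 &
  forall sg, sg = 1 \/ sg = -1 -> forall xi k n,
  \sum_(j < n) increment (fun s => edge (expR (sg * s) *: xi)) k j ^+ 2
  <= C * (rho ^+ k) ^+ 2].
Proof.
have RB0 : 0 <= R0 * B by rewrite mulr_ge0// ltW.
have [mu [H [mu0 mu1 H0 Hol]]] := powR_holder lam0 RB0.
pose V := Mal * (R0 `^ lam * B `^ lam + B `^ lam * R0 `^ lam) +
  R0 `^ lam * B `^ lam * (2 * L * R0).
pose Hc := 2 * L * R0 `^ (1 - mu) * (R0 `^ lam * B `^ lam) +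
   Mal * (H * (B + R0 * (M / r0 ^+ 2)) `^ mu).
pose Bm := Mal * (R0 `^ lam * B `^ lam).
pose E : R := expR 1.
have E1 : 1 < E by rewrite -expR0 ltr_expR.
have E0 : 0 < E by exact: expR_gt0.
have R0' := ltW R00.
have V0 : 0 <= V by rewrite addr_ge0 ?mulr_ge0 ?addr_ge0 ?mulr_ge0 ?powR_ge0.
have Bm0 : 0 <= Bm by rewrite !mulr_ge0 ?powR_ge0.
have Hc0 : 0 <= Hc by rewrite addr_ge0 ?mulr_ge0 ?powR_ge0.
pose K := r0 * (1 - E^-1).
have K0 : 0 < K by rewrite mulr_gt0// subr_gt0 invf_lt1.
pose C1 := Hc * (R0 * E) `^ mu * V.
pose C2 := Bm ^+ 2 / K * (E * R0).
have C10 : 0 <= C1 by rewrite !mulr_ge0 ?powR_ge0.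
have C20 : 0 <= C2.
  by rewrite /C2 mulr_ge0// ?divr_ge0 ?sqr_ge0 ?(ltW K0)// mulr_ge0// ltW.
pose rho : R := 2^-1 `^ (mu / 2).
have half01 : 0 < (2^-1 : R) < 1 by rewrite invr_gt0 ltr0n invf_lt1// ltr1n.
have rho0 : 0 < rho by rewrite powR_gt0//; case/andP: half01.
have rho1 : rho < 1.
  have -> : 1 = 1 `^ (mu / 2) :> R by rewrite powR1.
  by apply: gt0_ltr_powR; rewrite ?nnegrE ?divr_gt0 ?invr_ge0//; case/andP: half01.
have rhoE k : (rho ^+ k) ^+ 2 = (2^-1 ^+ k) `^ mu.
  rewrite -exprM mulnC exprM.
  have -> : rho ^+ 2 = 2^-1 `^ mu.
    by rewrite -powR_mulrn ?powR_ge0// -powRrM divfK.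
  rewrite -powR_mulrn ?powR_ge0// -powRrM mulrC powRrM powR_mulrn ?invr_ge0//.
exists (C1 + C2 + 1), rho; split; [by rewrite ltr_wpDl// addr_ge0|by rewrite rho0|].
move=> sg sg1 xi k n.
have CC : 0 <= C1 + C2 + 1 by rewrite !addr_ge0.
have [x0|xn0] := eqVneq (sup2 xi) 0.
  have e0 s : edge (expR (sg * s) *: xi) = 0.
    by apply: edge0; rewrite sup2_scale ?expR_ge0// x0 mulr0 ltNge (ltW r00).
  rewrite big1 => [|j _].
    by apply: mulr_ge0 => //; exact: sqr_ge0.
  by case: k => [|k] /=; rewrite !e0 ?subrr expr0n.
have x0 : 0 < sup2 xi by rewrite lt_neqAle eq_sym xn0 sup2_ge0.
pose w := (sup2 xi)^-1 *: xi.
have w1 : sup2 w = 1 by rewrite sup2_scale ?invr_ge0 ?sup2_ge0// mulVf.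
pose tau (s : R) := expR (sg * s) * sup2 xi.
have tau0 s : 0 < tau s by rewrite mulr_gt0// expR_gt0.
have edge_tau s : edge (expR (sg * s) *: xi) = edge (tau s *: w).
  by rewrite /tau /w scalerA mulfK.
have tauS s d : tau (s + d) = tau s * expR (sg * d).
  by rewrite /tau mulrDr expRD mulrAC.
have mtau (u : nat -> R) : (forall j, u j <= u j.+1) -> monotone_seq (tau \o u).
  move=> ule; rewrite /monotone_seq /tau/=.
  case: sg1 => ->; [left|right] => j; rewrite ler_pM2r// ler_expR.
    by rewrite !mul1r.
  by rewrite !mulN1r lerN2.
case: k => [|k].
  (* At unit mesh the values themselves must be summed.  The radii tau j are
     geometric of ratio E or 1/E; whenever tau j lies in the annulus, the next
     radius, clamped to the larger interval, is at distance at least K from it.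
     The clamped radii form a bounded monotone sequence, so this happens a
     bounded number of times. *)
  rewrite expr0 expr1n mulr1; pose y j := clamp (r0 / E) (E * R0) (tau j%:R).
  have rE : r0 / E <= r0 by rewrite ler_pdivrMr// ler_peMr// ltW.
  have RE : R0 <= E * R0 by rewrite ler_peMl// ltW.
  have step j : edge (expR (sg * j%:R) *: xi) ^+ 2 <= Bm ^+ 2 / K * `|y j.+1 - y j|.
    have BK : 0 <= Bm ^+ 2 / K by rewrite divr_ge0 ?sqr_ge0// ltW.
    rewrite edge_tau; have [tr|] := boolP (r0 < tau j%:R < R0); last first.
      move=> h; have -> : edge (tau j%:R *: w) = 0.
        by apply: edge0; rewrite sup2_scale ?(ltW (tau0 _))// w1 mulr1.
      by rewrite expr0n/= mulr_ge0.
    have /andP[rt tR] := tr; have t0 := tau0 j%:R.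
    have eB : edge (tau j%:R *: w) ^+ 2 <= Bm ^+ 2.
      rewrite -real_normK ?num_real// lerXn2r ?nnegrE// edge_le//.
      by rewrite (ltW rt) ltW.
    suff Ky : K <= `|y j.+1 - y j|.
      apply: (le_trans eB); rewrite -{1}(divfK (lt0r_neq0 K0) (Bm ^+ 2)).
      exact: ler_wpM2l.
    have -> : y j = tau j%:R.
      by rewrite /y clamp_id// (le_trans rE (ltW rt)) (le_trans (ltW tR) RE).
    have -> : y j.+1 = tau j%:R * expR sg.
      rewrite /y -natr1 tauS mulr1; apply: clamp_id; case: sg1 => ->.
        apply/andP; split; last by rewrite mulrC ler_pM2l// ltW.
        by rewrite (le_trans rE)// (le_trans (ltW rt))// ler_peMr ?(ltW t0)// ltW.
      rewrite expRN; apply/andP; split; first by rewrite ler_pM2r ?invr_gt0// ltW.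
      by rewrite (le_trans _ RE)// (le_trans _ (ltW tR))// ler_pdivrMr// ler_peMr// ltW.
    have EV1 : E^-1 < 1 by rewrite invf_lt1.
    have -> : tau j%:R * expR sg - tau j%:R = tau j%:R * (expR sg - 1).
      by rewrite mulrBr mulr1.
    rewrite normrM (gtr0_norm t0) /K; apply: ler_pM; rewrite ?subr_ge0 ?(ltW r00) ?(ltW EV1) ?(ltW rt)//.
    case: sg1 => ->; last by rewrite expRN distrC ger0_norm// subr_ge0 ltW.
    rewrite ger0_norm ?subr_ge0 ?(ltW E1)// -/E.
    have : E * E^-1 = 1 by rewrite mulfV// gt_eqF.
    by move: (E^-1) (EV1) => z z1 Ez; nra.
  apply: (@le_trans _ _ (\sum_(j < n) Bm ^+ 2 / K * `|y j.+1 - y j|)).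
    by apply: ler_sum => j _; exact: step.
  rewrite -mulr_sumr; apply: (@le_trans _ _ C2); last first.
    by rewrite addrAC lerDr addr_ge0.
  rewrite /C2 ler_wpM2l//; first by rewrite divr_ge0 ?sqr_ge0// ltW.
  have ylh j : r0 / E <= y j <= E * R0.
    by apply: clamp_itv; rewrite (le_trans rE)// (le_trans (ltW r0R0)).
  apply: (le_trans (variation_monotone n (monotone_clamp _ _ (mtau (fun j => j%:R) _)) ylh)).
    by move=> j; rewrite ler_nat.
  by rewrite lerBlDr lerDl divr_ge0// ltW.
pose x j := clamp r0 R0 (tau (dyadic k.+1 j)).
have mx : monotone_seq x.
  apply: monotone_clamp; apply: (mtau (dyadic k.+1)) => j.
  by rewrite dyadicS lerDl exprn_ge0// invr_ge0.
have xlh j : r0 <= x j <= R0 by apply: clamp_itv; exact: ltW.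
pose d : R := 2^-1 ^+ k.+1.
have d0 : 0 <= d by rewrite exprn_ge0// invr_ge0.
have d1 : d <= 1 by rewrite exprn_ile1 ?invr_ge0// ltW//; case/andP: half01.
have dx j : `|x j.+1 - x j| <= R0 * E * d.
  rewrite /x dyadicS -/d tauS; case: sg1 => ->.
    rewrite mul1r; apply: clamp_step; rewrite ?d0 ?d1//.
    by rewrite ler_peMr ?(ltW (tau0 _))// -expR0 ler_expR.
  have t0 := tau0 (dyadic k.+1 j); rewrite distrC mulN1r.
  apply: (@clamp_step _ _ d); rewrite ?d0 ?d1//.
  - by rewrite mulr_gt0// expR_gt0.
  - by rewrite ler_piMr ?(ltW t0)// -expR0 ler_expR oppr_le0.
  - by rewrite -mulrA -expRD addNr expR0 mulr1.
have inc j : increment (fun s => edge (expR (sg * s) *: xi)) k.+1 j =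
    edge (x j.+1 *: w) - edge (x j *: w).
  rewrite /increment (edge_tau (dyadic k.+1 j.+1)) (edge_tau (dyadic k.+1 j)).
  by rewrite (edge_clamp w1 (tau0 (dyadic k.+1 j.+1))) (edge_clamp w1 (tau0 (dyadic k.+1 j))).
rewrite (eq_bigr (fun j : 'I_n => (edge (x j.+1 *: w) - edge (x j *: w)) ^+ 2)); last first.
  by move=> j _; rewrite inc.
have hx j : `|edge (x j.+1 *: w) - edge (x j *: w)| <= Hc * (R0 * E * d) `^ mu.
  have mu01 : 0 < mu <= 1 by rewrite mu0.
  apply: (le_trans (edge_holder w1 mu01 H0 Hol (xlh j.+1) (xlh j))).
  apply: ler_wpM2l => //; apply: ge0_ler_powR; rewrite ?nnegrE ?(ltW mu0)//.
  by rewrite !mulr_ge0// ltW.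
apply: (le_trans (variation_sqr n (x := fun j => edge (x j *: w)) hx)).
apply: (@le_trans _ _ (Hc * (R0 * E * d) `^ mu * V)).
  apply: ler_wpM2l; first by rewrite mulr_ge0// powR_ge0.
  exact: edge_variation.
rewrite rhoE -/d powRM ?mulr_ge0 ?(ltW E0)//.
have -> : Hc * ((R0 * E) `^ mu * d `^ mu) * V = C1 * d `^ mu by rewrite /C1; ring.
apply: ler_wpM2r; first exact: powR_ge0.
by rewrite -addrA lerDl addr_ge0.
Qed.

Lemma edge_bound : exists Bm : R, forall x, `|edge x| <= Bm.
Proof.
exists (Mal * (R0 `^ lam * B `^ lam)) => x.
have Bm0 : 0 <= Mal * (R0 `^ lam * B `^ lam).
  by apply: mulr_ge0 => //; apply: mulr_ge0; exact: powR_ge0.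
have [/andP[rx xR]|h] := boolP (r0 < sup2 x < R0); last by rewrite edge0// normr0.
have x0 : 0 < sup2 x by exact: lt_trans rx.
have -> : x = sup2 x *: ((sup2 x)^-1 *: x) by rewrite scalerA mulfV ?gt_eqF// scale1r.
apply: edge_le; last by rewrite (ltW rx) ltW.
by rewrite sup2_scale ?invr_ge0 ?sup2_ge0// mulVf// gt_eqF.
Qed.

Lemma edge_support x : R0 <= sup2 x -> edge x = 0.
Proof. by move=> Rx; apply: edge0; rewrite negb_and -leNgt -leNgt Rx orbT. Qed.

Let plane := (measurableTypeR R * measurableTypeR R)%type.

Let continuous_al : continuous al.
Proof.
move=> x; apply/cvgrPdist_lt => e e0.
pose d := e / (2 * L + 1).
have L1 : 0 < 2 * L + 1 by rewrite ltr_wpDl// mulr_ge0.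
have d0 : 0 < d by rewrite divr_gt0.
near=> y.
have [/= xy1 xy2] : ball x d y by near: y; exact: (nbhsx_ballx x d d0).
apply: le_lt_trans (alL x y) _.
apply: (@le_lt_trans _ _ (L * (d + d))).
  by apply: ler_wpM2l => //; apply: lerD; exact: ltW.
have -> : e = (2 * L + 1) * d by rewrite /d mulrC divfK ?gt_eqF.
by rewrite mulrDl mul1r mulrDr -mulrA mulr_natl mulr2n ltrDl.
Unshelve. all: by end_near. Qed.

Let continuous_psi : continuous psi.
Proof.
move=> t; apply: differentiable_continuous; apply/derivable1_diffP.
by have := dpsi t => ?; exact: ex_derive.
Qed.

Let continuous_pow_pos : continuous (fun z : R => Num.max z 0 `^ lam).
Proof.
move=> z; have P0 : 0 <= `|z| + 1 by rewrite addr_ge0.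
have [mu [H [mu0 mu1 H0 Hol]]] := powR_holder lam0 P0.
apply/cvgrPdist_le => e e0.
pose d := (e / (H + 1)) `^ mu^-1.
have H1 : 0 < H + 1 by rewrite ltr_wpDl.
have d0 : 0 < d by apply: powR_gt0; exact: divr_gt0.
near=> y.
have yd : `|z - y| <= d by near: y; apply: cvgr_dist_le.
have y1 : `|z - y| <= 1 by near: y; apply: cvgr_dist_le.
have itv u : `|u| <= `|z| + 1 -> 0 <= Num.max u 0 <= `|z| + 1.
  by move=> uz; rewrite le_max lexx orbT ge_max P0 (le_trans (ler_norm _) uz).
have zP : `|z| <= `|z| + 1 by rewrite lerDl.
have yP : `|y| <= `|z| + 1.
  have -> : y = z - (z - y) by ring.
  by rewrite (le_trans (ler_normB _ _))// lerD2l.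
apply: (le_trans (Hol _ _ (itv _ zP) (itv _ yP))).
have dmu : `|Num.max z 0 - Num.max y 0| `^ mu <= e / (H + 1).
  have -> : e / (H + 1) = d `^ mu.
    by rewrite /d -powRrM mulVf ?gt_eqF// powRr1// divr_ge0// ltW.
  apply: ge0_ler_powR; rewrite ?nnegrE ?(ltW mu0) ?(ltW d0)//.
  by apply: le_trans (dist_max0 _ _) _; rewrite distrC.
apply: (le_trans (ler_wpM2l H0 dmu)).
by rewrite mulrCA ler_piMr ?(ltW e0)// ler_pdivrMr// mul1r lerDl.
Unshelve. all: by end_near. Qed.

Lemma continuous_edge_ray (sg : R) xi :
  continuous (fun s => edge (expR (sg * s) *: xi)).
Proof.
have cexp : continuous (fun s : R => expR (sg * s)).
  move=> s; apply: (@continuous_comp R R R (fun s => sg * s) (@expR R)).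
    exact: mulrl_continuous.
  exact: continuous_expR.
have c1 (c : R) : continuous (fun s : R => expR (sg * s) * c).
  by move=> s; apply: cvgM; [exact: cexp|exact: cvg_cst].
move=> s; apply: cvgM.
  apply: (@continuous_comp R (R * R)%type R (fun s => expR (sg * s) *: xi) al).
    exact: (cvg_pair (c1 xi.1 s) (c1 xi.2 s)).
  exact: continuous_al.
apply: (@continuous_comp R R R (fun s => (expR (sg * s) *: xi).2 - psi (expR (sg * s) *: xi).1)
  (fun z => Num.max z 0 `^ lam)); last exact: continuous_pow_pos.
apply: cvgB; first exact: c1.
apply: (@continuous_comp R R R (fun s => expR (sg * s) * xi.1) psi); first exact: c1.
exact: continuous_psi.
Qed.

Lemma measurable_edge : measurable_fun setT (edge : plane -> R).
Proof.
apply: measurable_funM; first exact: continuous_measurable_plane.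
apply: (@measurableT_comp _ _ _ _ _ _ (fun z : measurableTypeR R => Num.max z 0 `^ lam)).
  by apply: continuous_measurable_fun; exact: continuous_pow_pos.
apply: measurable_funB; first exact: measurable_snd.
apply: (measurableT_comp _ measurable_fst).
by apply: continuous_measurable_fun; exact: continuous_psi.
Qed.

Lemma measurable_edge_scale (c : R) :
  measurable_fun setT ((fun xi => edge (c *: xi)) : plane -> R).
Proof.
have mc : measurable_fun setT (fun xi : plane => (c * xi.1, c * xi.2) : plane).
  by apply: measurable_fun_pair; exact: measurable_funM.
exact: (measurableT_comp measurable_edge mc).
Qed.

Lemma integrable_square (A : R) : 0 <= A ->
  (@planar R).-integrable setT (EFin \o \1_(`[- A, A] `*` `[- A, A])).
Proof.
move=> A0; apply: integrable_indic_lty; first exact: measurableX.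
pose I : set R := `[- A, A]%classic.
have planarI : @planar R (I `*` I) = (lebesgue_measure I * lebesgue_measure I)%E.
  by apply: product_measure1E; exact: measurable_itv.
suff : (@planar R (I `*` I) < +oo)%E by [].
rewrite planarI !lebesgue_measure_itv/=.
by case: ifP => _; rewrite ?mul0e// -EFinM ltry.
Qed.

(** The supports of the dilates by e^t, t >= -S, lie in one square. *)
Lemma edge_scale_dominated (S : R) : exists2 Phi : R * R -> R,
  (@planar R).-integrable setT (EFin \o Phi) &
  forall t xi, - S <= t -> `|edge (expR t *: xi)| <= Phi xi.
Proof.
have [Bm Bm_ge] := edge_bound.
have Bm0 : 0 <= Bm by exact: le_trans (Bm_ge 0).
pose A := R0 * expR S.
have A0 : 0 <= A by rewrite mulr_ge0 ?expR_ge0// ltW.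
pose Sq : set (R * R) := `[- A, A] `*` `[- A, A].
exists (fun xi => Bm * \1_Sq xi).
  have -> : EFin \o (fun xi : R * R => Bm * \1_Sq xi) =
      (fun xi : R * R => Bm%:E * (EFin \o \1_Sq) xi)%E.
    by apply/funext => xi /=; rewrite EFinM.
  apply: integrableZl => //; exact: integrable_square.
move=> t xi St.
have [xR|Rx] := leP (sup2 xi) A.
  rewrite indicE mem_set ?mulr1//; move: xR; rewrite /sup2 ge_max => /andP[x1 x2].
  by split; rewrite /= in_itv/= -ler_norml.
rewrite edge_support ?normr0 ?mulr_ge0//.
rewrite sup2_scale ?expR_ge0// -(ler_pM2l (expR_gt0 (- t))) mulrA -expRD addNr expR0 mul1r.
apply: le_trans (ltW Rx); rewrite mulrC /A ler_wpM2l ?(ltW R00)// ler_expR.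
by rewrite lerNl.
Qed.

(** In [half_maximal] the dyadic chains start at the integer below s >= 0.
    Dilations by e^s and by e^-s are treated separately, and their majorants
    added. *)
Lemma edge_maximal : exists2 C, 0 < C & maximal_multiplier edge C.
Proof.
have [C [rho [C0 rho01 incr]]] := edge_increments.
have /andP[rho0 rho1] := rho01.
pose W := (1 - rho)^-1; pose C' := W * (W * (64 * C)).
have W0 : 0 < W by rewrite invr_gt0 subr_gt0.
have C'0 : 0 < C' by rewrite !mulr_gt0.
exists (C' + C'); first by rewrite addr_gt0.
split=> [t|t|b h Mh mh hM].
- exact: measurable_edge_scale.
- have [Phi iPhi Phi_ge] := edge_scale_dominated (- t).
  by exists Phi => // xi; apply: Phi_ge; rewrite opprK.
have half sg : sg = 1 \/ sg = -1 -> exists G : plane -> \bar R, [/\ measurable_fun setT G,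
    forall x, (0 <= G x)%E,
    forall s x, 0 <= s -> ((wave_integral b (fun xi => edge (expR (sg * s) *: xi)) h x ^+ 2)%:E <= G x)%E &
    (\int[@planar R]_x G x <= C'%:E * \int[@planar R]_xi (h xi ^+ 2)%:E)%E].
  move=> sg1; apply: (@half_maximal R (fun s xi => edge (expR (sg * s) *: xi)) C rho h Mh b) => //.
  - by move=> s; exact: measurable_edge_scale.
  - move=> S; have [Phi iPhi Phi_ge] := edge_scale_dominated S.
    exists Phi => // s xi /andP[s0 sS]; apply: Phi_ge.
    by case: sg1 => ->; rewrite ?mul1r ?mulN1r ?lerN2// (le_trans _ s0)// oppr_le0 (le_trans s0).
  - by move=> xi; exact: continuous_edge_ray.
  - by move=> xi k n; exact: incr.
have [G1 [mG1 G10 G1s G1i]] := half 1 (or_introl erefl).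
have [G2 [mG2 G20 G2s G2i]] := half (-1) (or_intror erefl).
exists (fun x => G1 x + G2 x)%E; split.
- exact: emeasurable_funD.
- by move=> x; rewrite adde_ge0.
- move=> t x; have [t0|t0] := leP 0 t.
    by have := G1s t x t0; rewrite mul1r => /le_trans; apply; rewrite leeDl.
  have := G2s (- t) x; rewrite mulN1r opprK oppr_ge0 => /(_ (ltW t0)) /le_trans; apply.
  by rewrite leeDr.
rewrite ge0_integralD// EFinD ge0_muleDl ?lee_fin ?(ltW C'0)//.
exact: leeD.
Qed.

End ray.

(** * Fourier transforms of Schwartz functions *)
Section transforms.
Context {R : realType}.
Local Notation plane := (measurableTypeR R * measurableTypeR R)%type.
Implicit Types (u v : R * R -> R).

Definition hat (b : bool) u (xi : R * R) : R :=
  Rintegral (@planar R) setT (fun x => u x * wave b (x, xi)).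

Lemma measurable_wave_fst b (y : plane) :
  measurable_fun setT (fun x : plane => wave b (x, y)).
Proof. exact: (measurableT_comp (measurable_wave b) (pair2_measurable y)). Qed.

Lemma integrable_wave b u (xi : R * R) : (@planar R).-integrable setT (EFin \o u) ->
  (@planar R).-integrable setT (EFin \o (fun x => u x * wave b (x, xi))).
Proof.
move=> iu; have mu_ : measurable_fun setT (u : plane -> R).
  by apply/measurable_EFinP; exact: measurable_int iu.
have iau : (@planar R).-integrable setT (EFin \o (fun x => `|u x|)).
  by move/integrable_abse : iu.
apply: (integrable_le _ _ iau).
  by apply: measurable_funM => //; exact: measurable_wave_fst.
by move=> x; rewrite normrM ler_piMr// wave_le1.
Qed.

Lemma measurable_hat b u : (@planar R).-integrable setT (EFin \o u) ->
  measurable_fun setT (hat b u : plane -> R).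
Proof.
move=> iu; apply: (measurable_Rintegral_snd planar (f := fun z : plane * plane => u z.1 * wave b z)).
apply: measurable_funM; last exact: measurable_wave.
have mu_ : measurable_fun setT (u : plane -> R).
  by apply/measurable_EFinP; exact: measurable_int iu.
exact: (measurableT_comp mu_ measurable_fst).
Qed.

Lemma hat_le b u xi : (@planar R).-integrable setT (EFin \o u) ->
  `|hat b u xi| <= Rintegral (@planar R) setT (fun x => `|u x|).
Proof.
move=> iu; have mu_ : measurable_fun setT (u : plane -> R).
  by apply/measurable_EFinP; exact: measurable_int iu.
apply: le_abs_Rintegral.
- by apply: measurable_funM => //; exact: measurable_wave_fst.
- by move=> x; rewrite normrM ler_piMr// wave_le1.
- by move/integrable_abse : iu.
Qed.

Lemma ge0_integral_sqrD (u1 u2 : plane -> R) : measurable_fun setT u1 -> measurable_fun setT u2 ->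
  (\int[@planar R]_x ((u1 x + u2 x) ^+ 2)%:E <=
   2%:E * (\int[@planar R]_x (u1 x ^+ 2)%:E + \int[@planar R]_x (u2 x ^+ 2)%:E))%E.
Proof.
move=> m1 m2.
have s1 : measurable_fun setT (fun x => (u1 x ^+ 2)%:E) by apply/measurable_EFinP; exact: measurable_funX.
have s2 : measurable_fun setT (fun x => (u2 x ^+ 2)%:E) by apply/measurable_EFinP; exact: measurable_funX.
have p1 (x : plane) : (0 <= (u1 x ^+ 2)%:E)%E by rewrite lee_fin sqr_ge0.
have p2 (x : plane) : (0 <= (u2 x ^+ 2)%:E)%E by rewrite lee_fin sqr_ge0.
rewrite -ge0_integralD// -ge0_integralZl//; last 2 first.
- exact: emeasurable_funD.
- by move=> x _; rewrite adde_ge0.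
apply: ge0_le_integral => //.
- by move=> x _; rewrite lee_fin sqr_ge0.
- by apply/measurable_EFinP; apply: measurable_funX; exact: measurable_funD.
- by apply: emeasurable_funM => //; exact: emeasurable_funD.
- move=> x _; rewrite -EFinD -EFinM lee_fin.
  by have := sqr_ge0 (u1 x - u2 x); rewrite sqrrB sqrrD; lra.
Qed.

(** Real and imaginary parts of a Fourier transform have this form, see
    [fourierE]; the constant is 2 * 64, with 64 from [bessel]. *)
Lemma integral_hat_sqrD b b' u v (s : R) : s = 1 \/ s = -1 ->
  (@planar R).-integrable setT (EFin \o u) -> (@planar R).-integrable setT (EFin \o v) ->
  (\int[@planar R]_xi ((hat b u xi + s * hat b' v xi) ^+ 2)%:E <=
   128%:E * \int[@planar R]_x (u x ^+ 2 + v x ^+ 2)%:E)%E.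
Proof.
move=> s1 iu iv.
have mu_ : measurable_fun setT (u : plane -> R).
  by apply/measurable_EFinP; exact: measurable_int iu.
have mv : measurable_fun setT (v : plane -> R).
  by apply/measurable_EFinP; exact: measurable_int iv.
apply: le_trans (ge0_integral_sqrD (measurable_hat b iu) _) _.
  by apply: measurable_funM => //; exact: measurable_hat.
have -> : (\int[@planar R]_xi ((s * hat b' v xi) ^+ 2)%:E =
           \int[@planar R]_xi (hat b' v xi ^+ 2)%:E)%E.
  apply: eq_integral => xi _; rewrite exprMn.
  by case: s1 => ->; rewrite ?sqrrN expr1n mul1r.
have -> : (\int[@planar R]_x (u x ^+ 2 + v x ^+ 2)%:E =
    \int[@planar R]_x (u x ^+ 2)%:E + \int[@planar R]_x (v x ^+ 2)%:E)%E.
  under eq_integral do rewrite EFinD.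
  rewrite ge0_integralD//; first by move=> x _; rewrite lee_fin sqr_ge0.
  - by apply/measurable_EFinP; exact: measurable_funX.
  - by move=> x _; rewrite lee_fin sqr_ge0.
  - by apply/measurable_EFinP; exact: measurable_funX.
have -> : 128%:E = (2%:E * 64%:E)%E :> \bar R by rewrite -EFinM; congr EFin; ring.
rewrite -muleA lee_pmul2l// [leRHS]ge0_muleDr; last 2 first.
- by apply: integral_ge0 => x _; rewrite lee_fin sqr_ge0.
- by apply: integral_ge0 => x _; rewrite lee_fin sqr_ge0.
apply: leeD; [exact: (bessel b iu)|exact: (bessel b' iv)].
Qed.

Lemma fourierE (f : R * R -> R[i]) xi :
  (@planar R).-integrable setT (EFin \o (fun x => complex.Re (f x))) ->
  (@planar R).-integrable setT (EFin \o (fun x => complex.Im (f x))) ->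
  fourier f xi =
  ((hat false (fun x => complex.Re (f x)) xi + 1 * hat true (fun x => complex.Im (f x)) xi) +i*
   (hat false (fun x => complex.Im (f x)) xi + (-1) * hat true (fun x => complex.Re (f x)) xi))%C.
Proof.
move=> i1 i2; rewrite /fourier /Cintegral mul1r mulN1r; congr Complex.
  rewrite -RintegralD//; [|exact: integrable_wave|exact: integrable_wave].
  apply: eq_Rintegral => x _; case: (f x) => a b.
  by rewrite /expi /wave/= cosN sinN mulrN opprK.
rewrite -RintegralB//; [|exact: integrable_wave|exact: integrable_wave].
apply: eq_Rintegral => x _; case: (f x) => a b.
by rewrite /expi /wave/= cosN sinN mulrN addrC.
Qed.

End transforms.

Section summability_of_schwartz_functions.
Context {R : realType}.
Local Notation plane := (measurableTypeR R * measurableTypeR R)%type.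

(** The moments of orders 0 and 2 in each variable add up to a bound of
    (1 + x_1^2) (1 + x_2^2) |u x|. *)
Lemma schwartz_integrable (u : R * R -> R) : continuous u -> rapidly_decreasing u ->
  (@planar R).-integrable setT (EFin \o u).
Proof.
move=> cu du.
have [M00 B00] := du 0%N 0%N [::]; have [M20 B20] := du 2%N 0%N [::].
have [M02 B02] := du 0%N 2%N [::]; have [M22 B22] := du 2%N 2%N [::].
pose M := M00 + M20 + M02 + M22.
pose k (t : R) := (oneDsqr t)^-1.
have ik : (@lebesgue_measure R).-integrable setT (EFin \o k).
  apply/integrableP; split.
    apply/measurable_EFinP; apply: continuous_measurable_fun; exact: continuous_oneDsqrV.
  rewrite (_ : (fun x => _) = (fun x => ((oneDsqr x)^-1)%:E)); last first.
    by apply/funext => x; rewrite /= ger0_norm// invr_ge0.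
  by rewrite integral_oneDsqrV ltry.
pose k2 (x : R * R) := k x.1 * k x.2.
have iMk : (@planar R).-integrable setT (EFin \o (fun x : R * R => M * k2 x)).
  have -> : EFin \o (fun x : R * R => M * k2 x) = (fun x : R * R => M%:E * (EFin \o k2) x)%E.
    by apply/funext => x /=; rewrite EFinM.
  apply: integrableZl => //; exact: (integrable_prod ik ik).
apply: (integrable_le _ _ iMk); first exact: continuous_measurable_plane.
move=> x; rewrite /k2 /k -invfM ler_pdivlMr; last by rewrite mulr_gt0.
have nn (c : R) : 0 <= c -> `|c * u x| = c * `|u x|.
  by move=> c0; rewrite normrM ger0_norm.
have := B00 x; have := B20 x; have := B02 x; have := B22 x.
have s1 := sqr_ge0 x.1; have s2 := sqr_ge0 x.2; have s12 := mulr_ge0 s1 s2.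
rewrite /= !expr0 !mul1r mulr1 (nn _ s1) (nn _ s2) (nn _ s12).
rewrite /M /oneDsqr; move: (`|u x|) (x.1 ^+ 2) (x.2 ^+ 2) => a s t *.
nra.
Qed.

End summability_of_schwartz_functions.

(** * From real to complex operators *)
Section complex_operators.
Context {R : realType}.
Local Notation plane := (measurableTypeR R * measurableTypeR R)%type.

Lemma normcE (z : R[i]) : Normc.normc z ^+ 2 = complex.Re z ^+ 2 + complex.Im z ^+ 2.
Proof. by case: z => x y /=; rewrite sqr_sqrtr// addr_ge0// sqr_ge0. Qed.

Lemma normc_ge0 (z : R[i]) : 0 <= Normc.normc z.
Proof. by case: z => x y; exact: sqrtr_ge0. Qed.

(** A product of three complex numbers has eight real terms, four in each
    component. *)
Lemma Cintegral_wave (m1 m2 h1 h2 : R * R -> R) (x : R * R) :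
  (@planar R).-integrable setT (EFin \o (fun xi => m1 xi * h1 xi)) ->
  (@planar R).-integrable setT (EFin \o (fun xi => m2 xi * h2 xi)) ->
  (@planar R).-integrable setT (EFin \o (fun xi => m1 xi * h2 xi)) ->
  (@planar R).-integrable setT (EFin \o (fun xi => m2 xi * h1 xi)) ->
  Cintegral (fun xi => (m1 xi +i* m2 xi)%C * (h1 xi +i* h2 xi)%C *
    expi (2 * pi * dot2 x xi)) =
  ((wave_integral false m1 h1 x - wave_integral false m2 h2 x -
      wave_integral true m1 h2 x - wave_integral true m2 h1 x) +i*
   (wave_integral true m1 h1 x - wave_integral true m2 h2 x +
      wave_integral false m1 h2 x + wave_integral false m2 h1 x))%C.
Proof.
move=> i11 i22 i12 i21.
have iw b u := @integrable_wave R b u x.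
have iB u v : (@planar R).-integrable setT (EFin \o u) ->
   (@planar R).-integrable setT (EFin \o v) ->
   (@planar R).-integrable setT (EFin \o (fun y => u y - v y)).
  move=> iu iv; have := integrableB measurableT iu iv.
  by apply: eq_integrable => // y _ /=; rewrite EFinB.
have iD u v : (@planar R).-integrable setT (EFin \o u) ->
   (@planar R).-integrable setT (EFin \o v) ->
   (@planar R).-integrable setT (EFin \o (fun y => u y + v y)).
  move=> iu iv; have := integrableD measurableT iu iv.
  by apply: eq_integrable => // y _ /=; rewrite EFinD.
rewrite /Cintegral; congr Complex.
  rewrite /wave_integral -RintegralB//; [|exact: iw|exact: iw].
  rewrite -RintegralB//; [|by apply: iB; exact: iw|exact: iw].
  rewrite -RintegralB//; [|by apply: (iB); [apply: (iB); exact: iw|exact: iw]|exact: iw].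
  apply: eq_Rintegral => xi _.
  by rewrite /wave/= dot2C /expi/=; ring.
rewrite /wave_integral -RintegralB//; [|exact: iw|exact: iw].
rewrite -RintegralD//; [|by apply: iB; exact: iw|exact: iw].
rewrite -RintegralD//; [|by apply: (iD); [apply: (iB); exact: iw|exact: iw]|exact: iw].
apply: eq_Rintegral => xi _.
by rewrite /wave/= dot2C /expi/=; ring.
Qed.

Lemma sqr_sum4 (a b c d : R) (sb sc sd : R) :
  sb ^+ 2 = 1 -> sc ^+ 2 = 1 -> sd ^+ 2 = 1 ->
  (a + sb * b + sc * c + sd * d) ^+ 2 <= 4 * (a ^+ 2 + b ^+ 2 + c ^+ 2 + d ^+ 2).
Proof.
move=> hb hc hd.
have -> : b ^+ 2 = (sb * b) ^+ 2 by rewrite exprMn hb mul1r.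
have -> : c ^+ 2 = (sc * c) ^+ 2 by rewrite exprMn hc mul1r.
have -> : d ^+ 2 = (sd * d) ^+ 2 by rewrite exprMn hd mul1r.
move: (sb * b) (sc * c) (sd * d) => b1 c1 d1.
have := sqr_ge0 (a - b1); have := sqr_ge0 (a - c1); have := sqr_ge0 (a - d1).
have := sqr_ge0 (b1 - c1); have := sqr_ge0 (b1 - d1); have := sqr_ge0 (c1 - d1).
rewrite !expr2; lra.
Qed.

(** The integral of a nonnegative function is a supremum over the simple functions
    below it, hence monotone on arbitrary functions, such as the maximal
    function, a supremum over uncountably many scales. *)
Lemma ge0_le_integral_nonmeasurable d (T : measurableType d)
    (mu : {measure set T -> \bar R}) (f1 f2 : T -> \bar R) :
  (forall x, 0 <= f1 x)%E -> (forall x, f1 x <= f2 x)%E ->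
  (\int[mu]_x f1 x <= \int[mu]_x f2 x)%E.
Proof.
move=> f10 f12; have f20 x : (0 <= f2 x)%E by exact: le_trans (f12 x).
rewrite !ge0_integralTE//; apply: le_ereal_sup => _ [h /= hf1 <-].
by exists h => // x; exact: le_trans (f12 x).
Qed.

End complex_operators.

Section maximal_operator.
Context {R : realType}.
Local Notation plane := (measurableTypeR R * measurableTypeR R)%type.

Lemma maximal_multiplier_integrable m C (h : R * R -> R) Mh t :
  maximal_multiplier m C -> measurable_fun setT (h : plane -> R) ->
  (forall xi, `|h xi| <= Mh) ->
  (@planar R).-integrable setT (EFin \o (fun xi => m (expR t *: xi) * h xi)).
Proof.
move=> [mm dom _] mh hM; have [Phi iPhi Phi_ge] := dom t.
have iM : (@planar R).-integrable setT (EFin \o (fun xi => Phi xi * Mh)).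
  have := integrableZr measurableT Mh iPhi.
  by apply: eq_integrable => // xi _ /=; rewrite EFinM.
apply: (integrable_le _ _ iM); first exact: measurable_funM.
by move=> xi; rewrite normrM ler_pM.
Qed.

(** [m false] and [m true] are the real and imaginary parts of the multiplier. *)
Variables (a : R * R -> R[i]) (psi : R -> R) (lam C : R).
Variable m : bool -> R * R -> R.
Hypothesis sigmaE : forall xi, sigma a psi lam xi = (m false xi +i* m true xi)%C.
Hypothesis mC : forall i, maximal_multiplier (m i) C.
Hypothesis C0 : 0 < C.

(** The terms of [Cintegral_wave], first those of the real part.  The entries
    select the component of the wave, of the multiplier and of the Fourier
    transform. *)
Let index8 := [:: (false, false, false); (false, true, true); (true, false, true);
  (true, true, false); (true, false, false); (true, true, true);
  (false, false, true); (false, true, false)].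

(** The constant counts eight terms with a factor 4 from [sqr_sum4], and 128 from
    [integral_hat_sqrD]. *)
Lemma S_op_maximal (f : R * R -> R[i]) :
  (@planar R).-integrable setT (EFin \o (fun x => complex.Re (f x))) ->
  (@planar R).-integrable setT (EFin \o (fun x => complex.Im (f x))) ->
  exists G : plane -> \bar R, [/\ measurable_fun setT G,
    forall x, (0 <= G x)%E,
    forall r x, 0 < r -> ((Normc.normc (S_op a psi lam r f x) ^+ 2)%:E <= G x)%E &
    (\int[@planar R]_x G x <=
      (32 * 128 * C)%:E * \int[@planar R]_x (Normc.normc (f x) ^+ 2)%:E)%E].
Proof.
set f1 := fun x => complex.Re (f x); set f2 := fun x => complex.Im (f x).
move=> if1 if2.
pose h (j : bool) : R * R -> R :=
  if j then fun xi => hat false f2 xi + (-1) * hat true f1 xi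
  else fun xi => hat false f1 xi + 1 * hat true f2 xi.
have mh j : measurable_fun setT (h j : plane -> R).
  by case: j; apply: measurable_funD; rewrite ?/h; try apply: measurable_funM => //;
    exact: measurable_hat.
pose Mh := Rintegral (@planar R) setT (fun x => `|f1 x|) +
           Rintegral (@planar R) setT (fun x => `|f2 x|).
have hM j xi : `|h j xi| <= Mh.
  case: j; rewrite /h ?mulN1r ?mul1r; apply: le_trans (ler_normD _ _) _;
    rewrite ?normrN /Mh; [rewrite addrC|]; by apply: lerD; exact: hat_le.
pose F := (\int[@planar R]_x (Normc.normc (f x) ^+ 2)%:E)%E.
have F0 : (0 <= F)%E by apply: integral_ge0 => x _; rewrite lee_fin sqr_ge0.
have hF j : (\int[@planar R]_xi (h j xi ^+ 2)%:E <= 128%:E * F)%E.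
  have -> : F = (\int[@planar R]_x (f1 x ^+ 2 + f2 x ^+ 2)%:E)%E.
    by apply: eq_integral => x _; rewrite normcE.
  case: j.
    have -> : (\int[@planar R]_x (f1 x ^+ 2 + f2 x ^+ 2)%:E =
      \int[@planar R]_x (f2 x ^+ 2 + f1 x ^+ 2)%:E)%E.
      by apply: eq_integral => x _; rewrite addrC.
    by apply: integral_hat_sqrD => //; right.
  by apply: integral_hat_sqrD => //; left.
pose P (k : bool * bool * bool) (G : plane -> \bar R) := [/\ measurable_fun setT G,
  forall x, (0 <= G x)%E,
  forall t x, ((wave_integral k.1.1 (fun xi => m k.1.2 (expR t *: xi)) (h k.2) x ^+ 2)%:E <= G x)%E &
  (\int[@planar R]_x G x <= C%:E * \int[@planar R]_xi (h k.2 xi ^+ 2)%:E)%E].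
have ex k : exists G, P k G.
  by have [_ _ /(_ k.1.1 (h k.2) Mh (mh k.2) (hM k.2))] := mC k.1.2.
pose G k := projT1 (cid (ex k)).
have GP k : P k (G k) by rewrite /G; case: cid.
have mG k : measurable_fun setT (G k) by have [] := GP k.
have G0 k x : (0 <= G k x)%E by have [] := GP k.
exists (fun x => 4%:E * \sum_(k <- index8) G k x)%E; split.
- by apply: emeasurable_funM => //; exact: emeasurable_sum.
- by move=> x; rewrite mule_ge0// sume_ge0.
- move=> r x r0; pose t := - ln r.
  have rt : r^-1 = expR t by rewrite /t expRN lnK.
  pose q k := wave_integral k.1.1 (fun xi => m k.1.2 (expR t *: xi)) (h k.2) x.
  have iq i j : (@planar R).-integrable setT
      (EFin \o (fun xi => m i (expR t *: xi) * h j xi)).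
    exact: (maximal_multiplier_integrable t (mC i) (mh j) (hM j)).
  have SE : S_op a psi lam r f x =
      ((q (false, false, false) - q (false, true, true) - q (true, false, true) -
          q (true, true, false)) +i*
       (q (true, false, false) - q (true, true, true) + q (false, false, true) +
          q (false, true, false)))%C.
    transitivity (Cintegral (fun xi => (m false (expR t *: xi) +i* m true (expR t *: xi))%C *
        (h false xi +i* h true xi)%C * expi (2 * pi * dot2 x xi))).
      rewrite /S_op; congr (Cintegral _); apply/funext => xi.
      by rewrite sigmaE rt fourierE.
    exact: Cintegral_wave.
  apply: (@le_trans _ _ (4 * \sum_(k <- index8) q k ^+ 2)%:E); last first.
    rewrite EFinM lee_pmul2l// -sumEFin; apply: lee_sum => k _.
    by have [_ _ h2 _] := GP k; exact: h2.
  rewrite lee_fin normcE SE /index8 !big_cons big_nil /=.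
  move: (q (false, false, false)) (q (false, true, true)) (q (true, false, true))
    (q (true, true, false)) (q (true, false, false)) (q (true, true, true))
    (q (false, false, true)) (q (false, true, false)).
  clear => q1 q2 q3 q4 q5 q6 q7 q8.
  have N1 : (-1 : R) ^+ 2 = 1 by rewrite sqrrN expr1n.
  have P1 : (1 : R) ^+ 2 = 1 by rewrite expr1n.
  have := sqr_sum4 q1 q2 q3 q4 N1 N1 N1; have := sqr_sum4 q5 q6 q7 q8 N1 P1 P1.
  rewrite !mulN1r !mul1r; lra.
have iG k : (\int[@planar R]_x G k x <= (128 * C)%:E * F)%E.
  have [_ _ _ h2] := GP k; apply: (le_trans h2).
  apply: le_trans (lee_wpmul2l _ (hF k.2)) _; first by rewrite lee_fin ltW.
  by rewrite muleA -EFinM [C * _]mulrC.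
rewrite ge0_integralZl//; [|exact: emeasurable_sum|by move=> x _; exact: sume_ge0].
rewrite ge0_integral_sum//.
apply: (@le_trans _ _ (4%:E * \sum_(k <- index8) ((128 * C)%:E * F))%E).
  by rewrite lee_pmul2l//; apply: lee_sum => k _; exact: iG.
have CF0 : (0 <= (128 * C)%:E)%E by rewrite lee_fin mulr_ge0// ltW.
rewrite -ge0_sume_distrl; last by move=> k _.
rewrite muleA /index8 !big_cons big_nil -!EFinD -EFinM lee_wpmul2r// lee_fin; lra.
Qed.

Lemma S_max_L2 : exists C' : R, 0 < C' /\ forall f : R * R -> R[i],
  (@planar R).-integrable setT (EFin \o (fun x => complex.Re (f x))) ->
  (@planar R).-integrable setT (EFin \o (fun x => complex.Im (f x))) ->
  ('N[@leb2 R]_2%:E[S_max a psi lam f] <=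
   C'%:E * 'N[@leb2 R]_2%:E[EFin \o (@Normc.normc R) \o f])%E.
Proof.
have K0 : 0 < 32 * 128 * C by rewrite !mulr_gt0// ltr0n.
exists ((32 * 128 * C) `^ 2^-1); split; first exact: powR_gt0.
move=> f if1 if2; have [G [mG G0 GS GI]] := S_op_maximal if1 if2.
have S0 x : (0 <= S_max a psi lam f x)%E.
  apply: (@le_trans _ _ (Normc.normc (S_op a psi lam 1 f x))%:E).
    by rewrite lee_fin normc_ge0.
  by apply: ereal_sup_ubound; exists 1 => //=.
have SG x : ((S_max a psi lam f x) `^ 2 <= G x)%E.
  have -> : G x = ((G x) `^ 2^-1 `^ 2)%E by rewrite -poweRrM mulVf// poweRe1.
  apply: gt0_ler_poweR => //; rewrite ?in_itv/= ?S0 ?poweR_ge0 ?leey//.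
  apply: ge_ereal_sup => _ [r /= r0 <-].
  have n0 := normc_ge0 (S_op a psi lam r f x).
  have -> : (Normc.normc (S_op a psi lam r f x))%:E =
      ((Normc.normc (S_op a psi lam r f x) ^+ 2)%:E `^ 2^-1)%E.
    by rewrite poweR_EFin -powR_mulrn// -powRrM mulfV// powRr1.
  apply: gt0_ler_poweR; rewrite ?invr_ge0// ?in_itv/= ?lee_fin ?sqr_ge0 ?leey ?G0//.
  exact: GS.
rewrite unlock /Lnorm.
have F2 : (\int[@leb2 R]_x (`|(EFin \o (@Normc.normc R) \o f) x| `^ 2) =
    \int[@planar R]_x (Normc.normc (f x) ^+ 2)%:E)%E.
  apply: eq_integral => x _; have n0 := normc_ge0 (f x).
  rewrite gee0_abs; last by rewrite lee_fin.
  by rewrite -powR_mulrn.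
rewrite F2 -poweR_EFin -poweRM; last 2 first.
- by rewrite lee_fin ltW.
- by apply: integral_ge0 => x _; rewrite lee_fin sqr_ge0.
apply: gt0_ler_poweR.
- by rewrite invr_ge0.
- by rewrite in_itv/= leey andbT; apply: integral_ge0 => x _; exact: poweR_ge0.
- rewrite in_itv/= leey andbT mule_ge0 ?lee_fin ?(ltW K0)//.
  by apply: integral_ge0 => x _; rewrite lee_fin sqr_ge0.
apply: le_trans GI; apply: ge0_le_integral_nonmeasurable => x; first exact: poweR_ge0.
by rewrite gee0_abs.
Qed.

End maximal_operator.

(** * The maximal theorem *)
Section phase_extension.
Context {R : realType}.
Variables (p q : R) (psi : R -> R).
Hypothesis pq : p <= q.
Hypothesis psiS : smooth_in `[p, q] psi.
Hypothesis nondegenerate : forall t : R, `[p, q]%classic t ->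
  psi t - t * deriv_in `[p, q] psi t != 0.

(** Agreement is asked on the interior only, where the amplitude lives; this
    includes the case of an interval reduced to a point. *)
Lemma phase_extension : exists psi' g : R -> R,
  [/\ forall t, (`[p, q]%classic : set R)^° t -> psi' t = psi t,
    forall t : R, is_derive t 1 psi' (g t),
    exists M, forall t, `|psi' t - t * g t| <= M &
    (forall t, 0 <= psi' t - t * g t) \/ (forall t, psi' t - t * g t <= 0)].
Proof.
move: pq; rewrite le_eqVlt => /predU1P[pq'|pq'].
  (* The interior is empty, so any phase of constant sign will do; the amplitude
     vanishes identically in this case. *)
  exists (cst 1), (cst 0); split.
  - by move=> t; rewrite pq' interior_itv/= in_itv/= => /andP[/lt_trans h /h]; rewrite ltxx.
  - by move=> t; exact: is_derive_cst.
  - by exists 1 => t; rewrite mulr0 subr0 normr1.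
  - by left=> t; rewrite mulr0 subr0.
exists (tangent_extension p q psi), (fun t => deriv_in `[p, q] psi (clamp p q t)).
split.
- move=> t; rewrite interior_itv/= in_itv/= => /andP[pt tq].
  by rewrite /tangent_extension clamp_id ?subrr ?mulr0 ?addr0// !ltW.
- by move=> t; exact: is_derive_tangent_extension.
- exact: tangent_extension_bounded.
- exact: tangent_extension_sign.
Qed.

End phase_extension.

Section support.
Context {R : realType}.

Lemma supp_subset (a : R * R -> R[i]) x : a x != 0 -> supp a x.
Proof. by move=> ax; apply: subset_closure. Qed.

Lemma supp_away_from_0 (a : R * R -> R[i]) : ~ supp a (0, 0) ->
  exists2 r, 0 < r & forall x, a x != 0 -> r < sup2 x.
Proof.
move=> a0.
have : nbhs (0, 0) (~` supp a : set (R * R)).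
  by apply: open_nbhs_nbhs; split => //; apply: closed_openC; exact: closed_closure.
move=> /nbhs_ballP[e /= e0 he]; exists (e / 2); first by rewrite divr_gt0.
move=> x ax; rewrite ltNge; apply/negP => xe.
have ee : e / 2 < e by rewrite ltr_pdivrMr// ltr_pMr// ltr1n.
apply: (he x) (supp_subset ax).
move: xe; rewrite /sup2 ge_max => /andP[x1 x2].
by split; rewrite /ball/= sub0r normrN (le_lt_trans _ ee).
Qed.

Lemma supp_bounded (a : R * R -> R[i]) : compact (supp a) ->
  exists A, forall x, a x != 0 -> sup2 x < A.
Proof.
move=> ca.
have bnd (F : R * R -> R) : continuous F -> exists M, forall x, supp a x -> `|F x| <= M.
  move=> cF.
  have [M [_ /(_ (`|M| + 1)) MF]] :=
    compact_bounded (continuous_compact (continuous_subspaceT cF) ca).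
  exists (`|M| + 1) => x ax; apply: MF; last by exists x.
  by rewrite (le_lt_trans (ler_norm M))// ltrDl.
have [M1 h1] := bnd fst (fun x => cvg_fst).
have [M2 h2] := bnd snd (fun x => cvg_snd).
exists (`|M1| + `|M2| + 1) => x /supp_subset ax; rewrite /sup2 gt_max.
have := h1 x ax; have := h2 x ax; have := ler_norm M1; have := ler_norm M2.
have := normr_ge0 M1; have := normr_ge0 M2.
move: `|M1| `|M2| `|x.1| `|x.2| => n1 n2 x1 x2 *; apply/andP; split; lra.
Qed.

End support.

Theorem theorem1p2 (R : realType) (p q : R) (psi : R -> R)
    (a : R * R -> R[i]) (lam : R)
    (hpq : p <= q)
    (hpsi : smooth_in `[p, q] psi)
    (ha : test_function a)
    (hsupp : supp a `<=` interior `[p, q] `*` setT)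
    (h0 : ~ supp a (0, 0))
    (hnd : forall t : R, `[p, q]%classic t ->
       psi t - t * deriv_in `[p, q] psi t != 0)
    (hlam : 0 < lam) :
  exists C : R, 0 < C /\
    forall f : R * R -> R[i], schwartz f ->
      ('N[leb2]_2%:E[S_max a psi lam f] <=
       C%:E * 'N[leb2]_2%:E[EFin \o (@Normc.normc R) \o f])%E.
Proof.
have [psi' [g [psiE dpsi [M kM] ksg]]] := phase_extension hpq hpsi hnd.
have [[sa1 sa2] ca] := ha.
have [r r0 ar] := supp_away_from_0 h0.
have [A aA] := supp_bounded ca.
pose R0 := Num.max A (r + 1).
have rR0 : r < R0 by rewrite lt_max ltrDl ltr01 orbT.
have R0_ge0 : 0 <= R0 by rewrite ltW// (lt_trans r0).
have R0N : - R0 <= R0 by rewrite lerNl (le_trans _ R0_ge0)// oppr_le0.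
have a_range x : a x != 0 -> r < sup2 x < R0.
  by move=> ax; rewrite ar//= lt_max aA.
have [Psi Psi_ge] : exists Psi, forall t, `|t| <= R0 -> `|psi' t| <= Psi.
  have cpsi : {within `[- R0, R0], continuous (fun t => `|psi' t|)}.
    apply: continuous_subspaceT => t.
    apply: (@continuous_comp R R R psi' (fun z => `|z|)); last exact: norm_continuous.
    by apply: differentiable_continuous; apply/derivable1_diffP; exact: ex_derive.
  have [c _ cmax] := EVT_max R0N cpsi.
  by exists `|psi' c| => t tR; apply: cmax; rewrite in_itv/= -ler_norml.
have Re0 x : ~ supp a x -> complex.Re (a x) = 0.
  by move=> nx; have [->//|/supp_subset] := eqVneq (a x) 0.
have Im0 x : ~ supp a x -> complex.Im (a x) = 0.
  by move=> nx; have [->//|/supp_subset] := eqVneq (a x) 0.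
pose al (i : bool) x := if i then complex.Im (a x) else complex.Re (a x).
have al_range i x : al i x != 0 -> r < sup2 x < R0.
  move=> alx; apply: a_range; apply: contra_neq alx => ax.
  by rewrite /al ax; case: i.
have mult i : exists2 C, 0 < C & maximal_multiplier (edge (al i) psi' lam) C.
  have [L L0 alL] : exists2 L, 0 <= L & forall x y, `|al i x - al i y| <=
      L * (`|x.1 - y.1| + `|x.2 - y.2|).
    case: i; first exact: compact_support_lipschitz ca Im0 sa2.
    exact: compact_support_lipschitz ca Re0 sa1.
  exact: (edge_maximal hlam r0 rR0 L0 alL (al_range i) dpsi kM ksg Psi_ge).
have [C1 C10 mC1] := mult false; have [C2 C20 mC2] := mult true.
have C12 : 0 < C1 + C2 by exact: addr_gt0.
have mC i : maximal_multiplier (edge (al i) psi' lam) (C1 + C2).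
  by case: i; [apply: maximal_multiplier_le mC2; rewrite lerDr ltW|
               apply: maximal_multiplier_le mC1; rewrite lerDl ltW].
have sigmaE xi : sigma a psi lam xi =
    (edge (al false) psi' lam xi +i* edge (al true) psi' lam xi)%C.
  rewrite /sigma /edge /al; have [->|axi] := eqVneq (a xi) 0.
    by rewrite !mul0r.
  have [/psiE -> _] := hsupp _ (supp_subset axi).
  by case: (a xi) => u v; simpc.
have [C [C0 CP]] := S_max_L2 sigmaE mC C12.
exists C; split=> // f [[sf1 sf2] df1 df2]; apply: CP.
- by apply: schwartz_integrable => //; exact: (sf1 [::]).1.
- by apply: schwartz_integrable => //; exact: (sf2 [::]).1.
Qed.
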